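(* Let $\mathcal{H}$ be a complex Hilbert space and let $A,B\in\mathcal{B}(\mathcal{H})$ be two strictly positive operators such that $m_1^2 I\le A\le M_1^2 I$ and $m_2^2 I\le B\le M_2^2 I$ for some positive scalars $m_1<M_1$, $m_2<M_2$. Let $\Phi$ be a normalized positive linear map on $\mathcal{B}(\mathcal{H})$. If $f$ is an operator monotone function on $(0,\infty)$, then \[ \begin{aligned} f\left(\left(\frac{M+m}{2}\right)\Phi(A\sharp B)\right) &\ge f\left(\frac{Mm\,\Phi(A)+\Phi(B)}{2}\right)\\ &\ge \frac{f(Mm\,\Phi(A))+f(\Phi(B))}{2}\\ &\ge f(Mm\,\Phi(A))\,\sharp\, f(\Phi(B)), \end{aligned} \] where $m=\frac{m_2}{M_1}$ and $M=\frac{M_2}{m_1}$.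
   Context: $\mathcal{B}(\mathcal{H})$ is the algebra of bounded linear operators on $\mathcal{H}$, with identity $I$. $A\ge 0$ (positive) means $\langle Ax,x\rangle\ge 0$ for all $x\in\mathcal{H}$; strictly positive means positive and invertible; $B\ge A$ means $B-A\ge 0$. A map $\Phi$ on $\mathcal{B}(\mathcal{H})$ is positive if $\Phi(A)\ge 0$ whenever $A\ge 0$, and normalized if $\Phi(I)=I$. For strictly positive $A,B$, the geometric mean is $A\sharp B=A^{1/2}(A^{-1/2}BA^{-1/2})^{1/2}A^{1/2}$. A continuous real valued function $f$ on $(0,\infty)$ is operator monotone if $B\ge A$ implies $f(B)\ge f(A)$ for all self-adjoint operators $A,B$ with spectra in $(0,\infty)$.
   Formalization: The last inequality is stated only when f(MmΦ(A)) and f(Φ(B)) are strictly positive, since otherwise (e.g. f = log) their geometric mean is undefined; operator monotone is read as monotone on every complex Hilbert space. *)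

(* Defs.v *)
From HB Require Import structures.
From mathcomp Require Import all_boot all_order all_algebra.
From mathcomp Require Import complex.
From mathcomp Require Import all_classical all_reals all_analysis.

Set Implicit Arguments.
Unset Strict Implicit.
Unset Printing Implicit Defensive.

Import Order.TTheory GRing.Theory Num.Theory.
Import numFieldNormedType.Exports.

Local Open Scope classical_set_scope.
Local Open Scope ring_scope.
Local Open Scope complex_scope.

(* The inner product is linear in its first argument and conjugate-linear in
   its second one (the convention of [{dot _ for _}]). *)
HB.mixin Record CompleteNormedModule_isHilbert (R : realType) H
    & CompleteNormedModule R[i] H := {
  hdot : {dot H for @Num.conj R[i]} ;
  sqr_normE : forall x : H, `|x| ^+ 2 = hdot x x
}.

#[short(type="hilbertType")]
HB.structure Definition Hilbert (R : realType) :=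
  {H of CompleteNormedModule R[i] H & CompleteNormedModule_isHilbert R H}.

Section BoundedOperators.
Context {R : realType} (H : hilbertType R).

Definition bounded_op : {pred H -> H} :=
  fun f => `[< linear f /\ bounded_near f (nbhs (0 : H)) >].

Lemma bounded_opP (f : H -> H) : reflect
  (linear f /\ exists2 c : R[i], 0 <= c & forall x, `|f x| <= c * `|x|)
  (f \in bounded_op).
Proof.
apply: (iffP (asboolP _)) => -[lf bf]; split => //.
  pose F : {linear H -> H} := HB.pack f (GRing.isLinear.Build _ _ _ _ _ lf).
  have /(linear_boundedP F)/pinfty_ex_gt0[c c0 cf] := bf.
  by exists c => //; exact: ltW.
pose F : {linear H -> H} := HB.pack f (GRing.isLinear.Build _ _ _ _ _ lf).
apply/(linear_boundedP F); case: bf => c c0 cf.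
exists c; split; first exact: ger0_real.
move=> r /ltW cr x; apply: le_trans (cf x) _.
by rewrite ler_wpM2r.
Qed.

Lemma bounded_op_submod : submod_closed bounded_op.
Proof.
split.
  apply/bounded_opP; split=> [a x y|]; first by rewrite scaler0 addr0.
  by exists 0 => // x; rewrite normr0 mul0r.
move=> a f g /bounded_opP[lf [c c0 cf]] /bounded_opP[lg [d d0 dg]].
apply/bounded_opP; split=> [b x y|].
  rewrite !fctE lf lg !scalerDr !scalerA [a * b]mulrC.
  by rewrite -!addrA; congr (_ + _); rewrite addrCA.
exists (`|a| * c + d) => [|x]; first by rewrite addr_ge0 ?mulr_ge0.
rewrite (le_trans (ler_normD _ _))// mulrDl lerD// normrZ -mulrA.
by rewrite ler_wpM2l.
Qed.

HB.instance Definition _ :=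
  GRing.isSubmodClosed.Build R[i] (H -> H) bounded_op bounded_op_submod.

Record bop := Bop { bop_fun :> H -> H ; bop_funP : bop_fun \in bounded_op }.

HB.instance Definition _ := [isSub for bop_fun].
HB.instance Definition _ := [Choice of bop by <:].
HB.instance Definition _ := [SubChoice_isSubLmodule of bop by <:].

Lemma bop_linear (A : bop) : linear A.
Proof. by have /bounded_opP[] := bop_funP A. Qed.

HB.instance Definition _ (A : bop) :=
  GRing.isLinear.Build _ _ _ _ (A : H -> H) (bop_linear A).

Lemma bopP (A B : bop) : (forall x, A x = B x) -> A = B.
Proof. by move=> AB; apply/val_inj/funext. Qed.

Lemma bop1_subproof : idfun \in bounded_op.
Proof.
apply/bounded_opP; split=> [a x y //|].
by exists 1 => // x; rewrite mul1r.
Qed.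

Lemma bopM_subproof (A B : bop) : A \o B \in bounded_op.
Proof.
have /bounded_opP[_ [c c0 cA]] := bop_funP A.
have /bounded_opP[_ [d d0 dB]] := bop_funP B.
apply/bounded_opP; split=> [a x y /=|]; first by rewrite !linearP.
exists (c * d) => [|x]; first exact: mulr_ge0.
by rewrite (le_trans (cA _))// -mulrA ler_wpM2l.
Qed.

Let bop1 := Bop bop1_subproof.
Let bopM A B := Bop (bopM_subproof A B).

Let bopMA : associative bopM. Proof. by move=> A B C; exact: bopP. Qed.
Let bop1M : left_id bop1 bopM. Proof. by move=> A; exact: bopP. Qed.
Let bopM1 : right_id bop1 bopM. Proof. by move=> A; exact: bopP. Qed.
Let bopDM : left_distributive bopM +%R.
Proof. by move=> A B C; exact: bopP. Qed.
Let bopMD : right_distributive bopM +%R.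
Proof. by move=> A B C; apply: bopP => x; rewrite /= linearD. Qed.

(* The product of operators is composition.  The ring is trivial when H is,
   hence a pzRingType only. *)
HB.instance Definition _ :=
  GRing.Zmodule_isPzRing.Build bop bopMA bop1M bopM1 bopDM bopMD.

End BoundedOperators.

Lemma bopE (R : realType) (H : hilbertType R) :
  (forall x, (0 : bop H) x = 0) *
  (forall x, (1 : bop H) x = x) *
  (forall (A : bop H) x, (- A) x = - A x) *
  (forall (A B : bop H) x, (A + B) x = A x + B x) *
  (forall a (A : bop H) x, (a *: A) x = a *: A x) *
  (forall (A B : bop H) x, (A * B) x = A (B x)).
Proof. by []. Qed.

Section OperatorOrder.
Context {R : realType} {H : hilbertType R}.
Implicit Types A B : bop H.

Definition self_adjoint A := forall x y, hdot (A x) y = hdot x (A y).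

(* The order of R[i] is partial: [0 <= z] says that z is real and
   nonnegative. *)
Definition positive_op A := forall x, 0 <= hdot (A x) x.

Definition invertible_op A := exists B, A * B = 1 /\ B * A = 1.

Definition strictly_positive_op A := positive_op A /\ invertible_op A.

Definition op_le A B := positive_op (B - A).

Definition spectrum A : set R[i] := [set z | ~ invertible_op (A - z *: (1 : bop H))].

Definition positive_map (Phi : bop H -> bop H) :=
  forall A, positive_op A -> positive_op (Phi A).

End OperatorOrder.

Section FunctionalCalculus.
Context {R : realType} {H : hilbertType R}.
Implicit Types (A T : bop H) (f : R -> R).

Definition op_poly (p : {poly R}) A : bop H :=
  \sum_(i < size p) (p`_i)%:C *: A ^+ i.

(* T = f(A): T is the limit in operator norm (i.e. uniformly on the unit ball)
   of p_n(A) for real polynomials p_n that converge to f uniformly on the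
   spectrum of A.  For A self-adjoint and f continuous on the spectrum of A,
   this is the continuous functional calculus. *)
Definition is_cfc f A T := exists p : nat -> {poly R},
  {uniform [set t | spectrum A t%:C], (fun n => horner (p n)) @ \oo --> f} /\
  {uniform [set x : H | `|x| <= 1],
    (fun n => op_poly (p n) A : H -> H) @ \oo --> (T : H -> H)}.

Definition cfc f A : bop H := xget 0 [set T | is_cfc f A T].

Definition op_powR A (r : R) : bop H := cfc (fun t => t `^ r) A.

Definition geo_mean A B : bop H :=
  op_powR A 2^-1 *
  op_powR (op_powR A (- 2^-1) * B * op_powR A (- 2^-1)) 2^-1 *
  op_powR A 2^-1.

End FunctionalCalculus.

(* Monotonicity is required on every complex Hilbert space, as usual: on a
   single space of finite dimension it would be a weaker property. *)
Definition operator_monotone (R : realType) (f : R -> R) :=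
  {in `]0, +oo[, continuous f} /\
  forall (H : hilbertType R) (A B : bop H),
    self_adjoint A -> self_adjoint B ->
    spectrum A `<=` [set z | 0 < z] -> spectrum B `<=` [set z | 0 < z] ->
    op_le A B -> op_le (cfc f A) (cfc f B).

(* Main.v *)
(* Write C for the square root of A^-1/2 B A^-1/2.  The bounds on A and B say
   that m <= C <= M, so (M - C) (C - m) >= 0; multiplying by A^1/2 on both sides
   gives (M + m) (A # B) >= M m A + B, and the first inequality follows by
   applying Phi and then f.  The last one is the arithmetic-geometric mean
   inequality, i.e. (1 - C)^2 >= 0 multiplied by A^1/2 on both sides, with A and
   B replaced by the values of f.

   The second inequality is the operator concavity of f.  On the Hilbert space
   H + H, put S = (A + B) / 2 and D = (B - A) / 2.  For every e > 0 the block
   operator [S, D; D, S] is dominated by diag(S + e, l) as soon as l is large.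
   The former acts as B on the vectors (x, x) and as A on the vectors (x, -x), so
   comparing the quadratic forms of the images by f of both operators at (x, 0)
   yields (f(A) + f(B)) / 2 <= f(S + e); then e tends to 0.

   The functional calculus rests on the Weierstrass approximation theorem and on
   the fact that p(A) >= 0 whenever A is self-adjoint and the polynomial p is
   nonnegative on the spectrum of A: the infimum of the numerical range of p(A)
   belongs to its spectrum, hence to the image by p of the spectrum of A. *)
Require Import Defs.
From HB Require Import structures.
From mathcomp Require Import all_boot all_order all_algebra.
From mathcomp Require Import ring lra.
From mathcomp Require Import complex.
From mathcomp Require Import all_classical all_reals all_analysis.

Set Implicit Arguments.
Unset Strict Implicit.
Unset Printing Implicit Defensive.

Import Order.TTheory GRing.Theory Num.Theory.
Import numFieldNormedType.Exports.

Local Open Scope classical_set_scope.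
Local Open Scope ring_scope.
Local Open Scope complex_scope.

Local Notation Re := complex.Re.
Local Notation Im := complex.Im.

(** * Weierstrass approximation *)

Section Bernstein.
Context {R : realType}.
Implicit Types (g h : nat -> R) (x c : R).

(* (bernstein n g).[x] is the expectation of g at a binomial variable of
   parameters n and x; conditioning on the first trial gives the recursion, with
   which moments are computed by induction, without any binomial coefficient. *)
Fixpoint bernstein n g : {poly R} :=
  if n is m.+1 then (1 - 'X) * bernstein m g + 'X * bernstein m (g \o succn)
  else (g 0)%:P.

Lemma bernsteinS n g x : (bernstein n.+1 g).[x] =
  (1 - x) * (bernstein n g).[x] + x * (bernstein n (g \o succn)).[x].
Proof. by rewrite /= !hornerE. Qed.

Lemma ler_bernstein n g h x : 0 <= x <= 1 ->
  (forall k, (k <= n)%N -> g k <= h k) ->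
  (bernstein n g).[x] <= (bernstein n h).[x].
Proof.
move=> x01; have /andP[x0 x1] := x01.
elim: n g h => [|n IH] g h gh; first by rewrite !hornerC gh.
rewrite !bernsteinS lerD// ler_wpM2l ?subr_ge0//; apply: IH => k kn.
- by rewrite gh// leqW.
- by rewrite /= gh.
Qed.

(** For a binomial variable X of parameters n and x, the expectation of (X - c)^2 is the squared
    bias plus the variance n x (1 - x). The induction varies c, since a first success replaces c by
    c - 1. *)
Lemma bernstein_quadratic n (a b c x : R) :
  (bernstein n (fun k => a + b * (k%:R - c) ^+ 2)).[x] =
  a + b * ((n%:R * x - c) ^+ 2 + n%:R * x * (1 - x)).
Proof.
elim: n c => [|n IH] c; first by rewrite /= !hornerE; ring.
rewrite bernsteinS IH.
have -> : ((fun k : nat => a + b * (k%:R - c) ^+ 2) \o succn) =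
   (fun k : nat => a + b * (k%:R - (c - 1)) ^+ 2).
  by apply/funext => k /=; rewrite -natr1; ring.
by rewrite IH -natr1; ring.
Qed.

(** Compactness of the segment. Only x is confined to it: y may lie outside, which later allows a
    shift of the spectrum beyond b. *)
Lemma continuous_uniformly (f : R -> R) (a b e : R) : 0 < e ->
  {in `[a, b], continuous f} ->
  exists2 d, 0 < d &
    forall x y, x \in `[a, b] -> `|y - x| < d -> `|f y - f x| <= e.
Proof.
move=> e0 cf.
have /compact_near_coveringP K := @segment_compact R a b.
pose P (d x : R) := forall y, `|y - x| < d -> `|f y - f x| <= e.
have /(K _ (0 : R)^'+ P _) H : forall x, `[a, b]%classic x ->
    \forall x' \near x & d \near (0 : R)^'+, P d x'.
  move=> x /= /cf /cvgrPdist_lt /(_ (e / 2)); rewrite divr_gt0// => /(_ isT).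
  move=> /nbhs_ballP[r /= r0 rP].
  exists (ball x (r / 2), [set d | d < r / 2]) => /=.
    split; first by apply: nbhsx_ballx; rewrite divr_gt0.
    by apply: nbhs_right_lt; rewrite divr_gt0.
  move=> [x' d] /= [xx' dr] y yx'.
  have xr : `|x - x'| < r / 2 by [].
  have fx' : `|f x - f x'| < e / 2.
    by apply: rP; rewrite /ball /=; lra.
  have fy : `|f x - f y| < e / 2.
    apply: rP; rewrite /ball /= (le_lt_trans (ler_distD x' _ _))//.
    by rewrite (distrC x'); lra.
  rewrite (le_trans (ler_distD (f x) _ _))// (distrC (f y)); lra.
have [d /= [dP d0]] : exists d, (`[a, b] `<=` P d) /\ 0 < d.
  near (0 : R)^'+ => d; exists d; split; last by near: d; exact: nbhs_right_gt.
  by near: d.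
by exists d => // x y xab; exact: dP.
Unshelve. all: by end_near. Qed.

(** Close points are controlled by uniform continuity, distant ones by the oscillation of f divided
    by d^2. The bound is quadratic because [bernstein_quadratic] computes the expectation of such a
    bound exactly. *)
Lemma continuous_quadratic_modulus (f : R -> R) (e : R) : 0 < e ->
  {in `[0, 1], continuous f} ->
  exists2 K, 0 <= K & forall x y, x \in `[0, 1] -> y \in `[0, 1] ->
    `|f y - f x| <= e + K * (y - x) ^+ 2.
Proof.
move=> e0 cf; have [d d0 fd] := continuous_uniformly e0 cf.
have cf' : {within `[0 : R, 1], continuous f}.
  by apply: continuous_in_subspaceT => x; rewrite inE /= => /cf.
have [xM _ fM] := EVT_max (@ler01 R) cf'.
have [xm xm01 fm] := EVT_min (@ler01 R) cf'.
have D0 : 0 <= f xM - f xm by rewrite subr_ge0 fM.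
exists ((f xM - f xm) / d ^+ 2) => [|x y x01 y01].
  by rewrite divr_ge0// sqr_ge0.
have [yx|dyx] := ltP `|y - x| d.
  rewrite (le_trans (fd _ _ x01 yx))// lerDl mulr_ge0 ?sqr_ge0//.
  by rewrite divr_ge0// sqr_ge0.
apply: (@le_trans _ _ (f xM - f xm)).
  have := fM _ x01; have := fM _ y01; have := fm _ x01; have := fm _ y01.
  by move=> a1 a2 a3 a4; rewrite ler_norml; apply/andP; split; lra.
rewrite -[leLHS]mulr1 -mulrA -[leLHS]add0r lerD ?(ltW e0)// ler_wpM2l//.
rewrite mulrC ler_pdivlMr ?exprn_gt0// mul1r -[leRHS]real_normK ?num_real//.
by rewrite ler_sqr ?nnegrE ?(ltW d0).
Qed.

(** The values f (k / n) lie between two quadratic functions of k centred at n x, so by monotonicity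
    of [bernstein] the error is at most e / 2 plus a variance term bounded by K / n. *)
Lemma weierstrass01 (f : R -> R) (e : R) : 0 < e -> {in `[0, 1], continuous f} ->
  exists p : {poly R}, forall x, x \in `[0, 1] -> `|p.[x] - f x| <= e.
Proof.
move=> e0 cf.
have e20 : 0 < e / 2 by rewrite divr_gt0.
have [K K0 fK] := continuous_quadratic_modulus e20 cf.
pose n := (Num.bound (K / (e / 2))).+1.
have nK : K / n%:R <= e / 2.
  rewrite ler_pdivrMr ?ltr0Sn// mulrC -ler_pdivrMr//.
  rewrite (le_trans (ltW (archi_boundP (divr_ge0 K0 (ltW e20)))))//.
  by rewrite ler_nat.
exists (bernstein n (fun k => f (k%:R / n%:R))) => x x01.
have n0 : (0 : R) < n%:R by rewrite ltr0Sn.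
have k01 k : (k <= n)%N -> (k%:R / n%:R : R) \in `[0, 1].
  move=> kn; rewrite in_itv/= divr_ge0//=.
  by rewrite ler_pdivrMr// mul1r ler_nat.
have x01' : 0 <= x <= 1 by move: x01; rewrite in_itv.
(* The sign s yields the upper and the lower quadratic bound at once. *)
have q s k : (s = 1 \/ s = -1) -> (k <= n)%N ->
    s * (f (k%:R / n%:R) - f x) <=  e / 2 + K / n%:R ^+ 2 * (k%:R - n%:R * x) ^+ 2.
  move=> s1 kn; have -> : K / n%:R ^+ 2 * (k%:R - n%:R * x) ^+ 2 =
     K * (k%:R / n%:R - x) ^+ 2 by field; rewrite lt0r_neq0.
  apply: le_trans (fK _ _ x01 (k01 _ kn)).
  by case: s1 => ->; rewrite ?mul1r ?mulN1r ?ler_norm// -normrN ler_norm.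
have E : K / n%:R ^+ 2 * ((n%:R * x - n%:R * x) ^+ 2 + n%:R * x * (1 - x)) <= e / 2.
  have -> : K / n%:R ^+ 2 * ((n%:R * x - n%:R * x) ^+ 2 + n%:R * x * (1 - x))
    = K / n%:R * (x * (1 - x)) by field; rewrite lt0r_neq0.
  apply: le_trans nK; rewrite ler_piMr// ?divr_ge0// ?(ltW n0)//; nra.
have up := @ler_bernstein n _ (fun k =>
  (f x + e / 2) + K / n%:R ^+ 2 * (k%:R - n%:R * x) ^+ 2) x x01'.
have dn := @ler_bernstein n (fun k =>
  (f x - e / 2) + - (K / n%:R ^+ 2) * (k%:R - n%:R * x) ^+ 2)
  (fun k => f (k%:R / n%:R)) x x01'.
move: up dn; rewrite !bernstein_quadratic mulNr.
move=> /(_ (fun k => f (k%:R / n%:R)))/= up dn.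
rewrite ler_distl; apply/andP; split.
- apply: le_trans (dn _); first by lra.
  by move=> k /(q _ _ (or_intror erefl)); lra.
- apply: (le_trans (up _)); last by lra.
  by move=> k /(q _ _ (or_introl erefl)); lra.
Qed.

Lemma weierstrass (f : R -> R) (a b e : R) : 0 < e ->
  {in `[a, b], continuous f} ->
  exists p : {poly R}, forall x, x \in `[a, b] -> `|p.[x] - f x| <= e.
Proof.
have [ab|ba] := ltP a b; last first.
  move=> e0 cf; exists (f a)%:P => x; rewrite in_itv/= => axb.
  have -> : x = a by move: axb; lra.
  by rewrite hornerC subrr normr0 ltW.
have ba0 : 0 < b - a by rewrite subr_gt0.
move=> e0 cf; have [|p pP] := @weierstrass01 (fun t => f (a + (b - a) * t)) e e0.
  move=> t t01; apply: continuous_comp; last first.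
    by apply: cf; move: t01; rewrite !in_itv/= => ?; nra.
  apply: continuousD; first exact: cvg_cst.
  by apply: continuousM; [exact: cvg_cst|exact: cvg_id].
exists (p \Po ((b - a)^-1 *: ('X - a%:P))) => x xab.
rewrite horner_comp !hornerE.
set t := _ * (x - a); have tE : a + (b - a) * t = x.
  by rewrite /t; field; rewrite lt0r_neq0.
rewrite -[X in f X]tE; apply: pP.
move: xab; rewrite -[X in X \in _]tE !in_itv/= => xab; clearbody t; nra.
Qed.
End Bernstein.

(** * The real inner product of a complex Hilbert space *)

Section RealInnerProduct.
Context {R : realType} {H : hilbertType R}.
Implicit Types (x y z : H) (r : R).

(** The real part makes H a real inner product space, where inequalities are plain real arithmetic;
    [Im_hdot] recovers the imaginary part. *)
Definition rdot x y : R := Re (hdot x y).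

Lemma rdotC x y : rdot x y = rdot y x.
Proof. by rewrite /rdot hermC /= expr0 mul1r; case: (hdot y x). Qed.

Lemma rdotDl x y z : rdot (x + y) z = rdot x z + rdot y z.
Proof. by rewrite /rdot linearDl raddfD. Qed.

Lemma rdotDr x y z : rdot z (x + y) = rdot z x + rdot z y.
Proof. by rewrite rdotC rdotDl !(rdotC z). Qed.

Lemma rdotZl r x y : rdot (r%:C *: x) y = r * rdot x y.
Proof.
by rewrite /rdot linearZl_LR /=; case: (hdot x y) => ? ? /=; rewrite mul0r subr0.
Qed.

Lemma rdotZr r x y : rdot x (r%:C *: y) = r * rdot x y.
Proof. by rewrite rdotC rdotZl rdotC. Qed.

Lemma rdotNl x y : rdot (- x) y = - rdot x y.
Proof. by rewrite /rdot linearNl raddfN. Qed.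

Lemma rdotNr x y : rdot x (- y) = - rdot x y.
Proof. by rewrite rdotC rdotNl rdotC. Qed.

Lemma rdot0l y : rdot 0 y = 0.
Proof. by rewrite /rdot linear0l. Qed.

Lemma rdot0r y : rdot y 0 = 0.
Proof. by rewrite rdotC rdot0l. Qed.

Lemma rdot_i x y : rdot ('i *: x) ('i *: y) = rdot x y.
Proof.
rewrite /rdot linearZl_LR linearZr_LR /=; case: (hdot x y) => a b /=.
ring.
Qed.

Lemma Im_hdot x y : Im (hdot x y) = rdot x ('i *: y).
Proof.
rewrite /rdot linearZr_LR /=; case: (hdot x y) => a b /=; ring.
Qed.

(** The norm of H takes its values in R[i]; this is the same norm with values in R. *)
Definition hnorm x : R := Num.sqrt (rdot x x).

Lemma hdotxx x : hdot x x = (rdot x x)%:C.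
Proof.
have : 0 <= hdot x x by rewrite -sqr_normE exprn_ge0.
by rewrite /rdot; case: (hdot x x) => a b; rewrite lecE /= => /andP[/eqP-> _].
Qed.

Lemma rdotxx_ge0 x : 0 <= rdot x x.
Proof. by rewrite -lecR -hdotxx -sqr_normE exprn_ge0. Qed.

Lemma hnorm_sqr x : hnorm x ^+ 2 = rdot x x.
Proof. by rewrite sqr_sqrtr// rdotxx_ge0. Qed.

Lemma hnorm_ge0 x : 0 <= hnorm x.
Proof. exact: sqrtr_ge0. Qed.

Lemma normE_hnorm x : `|x| = (hnorm x)%:C.
Proof.
apply/eqP; rewrite -(@eqrXn2 _ 2)// ?lecR ?hnorm_ge0//.
by rewrite sqr_normE hdotxx -hnorm_sqr -rmorphXn.
Qed.

Lemma hnormD x y : hnorm (x + y) <= hnorm x + hnorm y.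
Proof. by rewrite -lecR rmorphD/= -!normE_hnorm ler_normD. Qed.

Lemma hnormN x : hnorm (- x) = hnorm x.
Proof. by apply: complexI; rewrite -!normE_hnorm normrN. Qed.

Lemma hnormBC x y : hnorm (x - y) = hnorm (y - x).
Proof. by rewrite -hnormN opprB. Qed.

Lemma hnorm_dist z x y : hnorm (x - y) <= hnorm (x - z) + hnorm (z - y).
Proof. by rewrite -[x - y](subrKA z) hnormD. Qed.

Lemma hnorm0 : hnorm 0 = 0.
Proof. by rewrite /hnorm rdot0l sqrtr0. Qed.

Lemma hnorm_eq0 x : hnorm x = 0 -> x = 0.
Proof. by move=> x0; apply/eqP; rewrite -normr_eq0 normE_hnorm x0. Qed.

Lemma hnormZ r x : hnorm (r%:C *: x) = `|r| * hnorm x.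
Proof. by rewrite /hnorm rdotZl rdotZr mulrA -expr2 sqrtrM ?sqr_ge0// sqrtr_sqr. Qed.

(** Cauchy-Schwarz is read off the squared triangle inequality, which the normed structure already
    provides. *)
Lemma rdot_le_hnorm x y : rdot x y <= hnorm x * hnorm y.
Proof.
have := hnormD x y.
rewrite -(@ler_pXn2r _ 2)// ?nnegrE ?addr_ge0 ?hnorm_ge0//.
rewrite hnorm_sqr rdotDl !rdotDr -!hnorm_sqr (rdotC y x).
nra.
Qed.

Lemma normr_rdot_le_hnorm x y : `|rdot x y| <= hnorm x * hnorm y.
Proof.
by rewrite ler_norml rdot_le_hnorm andbT lerNl -rdotNl -(hnormN x) rdot_le_hnorm.
Qed.

Lemma hilbert_complete (u : nat -> H) :
  (forall e : R, 0 < e ->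
    exists N, forall m n, (N <= m)%N -> (N <= n)%N -> hnorm (u m - u n) <= e) ->
  exists l, forall e : R, 0 < e -> exists N, forall n, (N <= n)%N -> hnorm (u n - l) <= e.
Proof.
move=> uC; have : cvg (u @ \oo).
  apply/cauchy_cvgP/cauchyP => /= e e0.
  have eE : e = (Re e)%:C.
    by move: e0; case: e => a b; rewrite ltcE /= => /andP[/eqP-> _].
  have {}e0 : 0 < Re e by move: e0; rewrite eE ltcR.
  have [N NP] := uC (Re e / 2) (divr_gt0 e0 (ltr0Sn _ 1)).
  exists (u N); exists N => //= n /= Nn.
  rewrite -ball_normE /= normE_hnorm eE ltcR (le_lt_trans (NP _ _ _ _))//.
  by rewrite gtr_pMr// invf_lt1// ltr1n.
move=> /cvg_ex[l ul]; exists l => e e0.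
move/cvgrPdist_lt : ul => /(_ e%:C); rewrite ltcR => /(_ e0)[N _ NP].
exists N => n Nn; apply: ltW; rewrite -ltcR -normE_hnorm distrC.
exact: NP.
Qed.

End RealInnerProduct.

(** * Self-adjoint and coercive operators *)

Section Operators.
Context {R : realType} {H : hilbertType R}.
Implicit Types (A B S T : bop H) (x y : H) (r c : R).

Definition sym_op A := forall x y, rdot (A x) y = rdot x (A y).

(** The imaginary part of the inner product is its real part against ['i *: y], and A commutes with
    multiplication by ['i]. *)
Lemma self_adjointP A : self_adjoint A <-> sym_op A.
Proof.
split=> [sA x y|sA x y]; first by rewrite /rdot sA.
apply/eqP; rewrite eq_complex; apply/andP; split; apply/eqP; first exact: sA.
by rewrite !Im_hdot sA linearZ.
Qed.

Lemma i_scalerK x : 'i *: (- 'i *: x) = x.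
Proof. by rewrite scalerA mulrN -expr2 sqr_i opprK scale1r. Qed.

Lemma rdot_iC x y : rdot ('i *: x) y = - rdot x ('i *: y).
Proof.
by rewrite -{1}(i_scalerK y) rdot_i scaleNr rdotNr.
Qed.

(** Over the complex numbers positivity forces symmetry: the imaginary part of the form vanishes at
    every vector, and polarization at x + y gives the identity for pairs. *)
Lemma positive_opP A : positive_op A <-> sym_op A /\ forall x, 0 <= rdot (A x) x.
Proof.
split=> [pA|[/self_adjointP sA pA] x]; last first.
  have : Im (hdot (A x) x) = 0.
    have := hermC hdot (A x) x; rewrite /= expr0 mul1r -sA.
    by case: (hdot (A x) x) => a b [] /=; lra.
  by have := pA x; rewrite /rdot; case: (hdot _ _) => a b /= a0 ->; rewrite lecE /= eqxx.
split=> [|x]; last by have := pA x; rewrite lecE => /andP[].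
have I0 x : rdot (A x) ('i *: x) = 0.
  by rewrite -Im_hdot; have := pA x; rewrite lecE /= => /andP[/eqP].
have I1 x y : rdot (A x) ('i *: y) = rdot x (A ('i *: y)).
  have := I0 (x + y); rewrite linearD scalerDr rdotDl !rdotDr !I0 linearZ /=.
  rewrite -[rdot x _]opprK -rdot_iC (rdotC ('i *: x)); lra.
by move=> x y; rewrite -(i_scalerK y) I1.
Qed.

Lemma op_leP A B : op_le A B <->
  sym_op (B - A) /\ forall x, rdot (A x) x <= rdot (B x) x.
Proof.
rewrite /op_le positive_opP.
by split=> -[sAB AB]; split=> // x; have := AB x; rewrite !bopE rdotDl rdotNl subr_ge0.
Qed.

Lemma sym_op0 : sym_op 0. Proof. by move=> x y; rewrite !bopE rdot0l rdot0r. Qed.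

Lemma sym_op1 : sym_op 1. Proof. by move=> x y; rewrite !bopE. Qed.

Lemma sym_opD A B : sym_op A -> sym_op B -> sym_op (A + B).
Proof. by move=> sA sB x y; rewrite !bopE rdotDl rdotDr sA sB. Qed.

Lemma sym_opN A : sym_op A -> sym_op (- A).
Proof. by move=> sA x y; rewrite !bopE rdotNl rdotNr sA. Qed.

Lemma sym_opB A B : sym_op A -> sym_op B -> sym_op (A - B).
Proof. by move=> sA sB; apply: sym_opD => //; exact: sym_opN. Qed.

Lemma sym_opZ r A : sym_op A -> sym_op (r%:C *: A).
Proof. by move=> sA x y; rewrite !bopE rdotZl rdotZr sA. Qed.

Lemma sym_opM A B : sym_op A -> sym_op B -> A * B = B * A -> sym_op (A * B).
Proof. by move=> sA sB AB x y; rewrite {1}AB !bopE sB sA. Qed.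

Lemma sym_opX A n : sym_op A -> sym_op (A ^+ n).
Proof.
move=> sA; elim: n => [|n IH]; first by rewrite expr0; exact: sym_op1.
by rewrite exprS; apply: sym_opM => //; rewrite -exprSr exprS.
Qed.

Lemma bop_scalerAl (a : R[i]) A B : (a *: A) * B = a *: (A * B).
Proof. by apply: bopP => x; rewrite !bopE. Qed.

Lemma bop_scalerAr (a : R[i]) A B : A * (a *: B) = a *: (A * B).
Proof. by apply: bopP => x; rewrite !bopE linearZ. Qed.

Lemma bop_bound A : exists2 K : R, 0 < K & forall x, hnorm (A x) <= K * hnorm x.
Proof.
have /bounded_opP[_ [c c0 cA]] := bop_funP A.
have cE : c = (Re c)%:C.
  by move: c0; case: (c) => a b; rewrite lecE /= => /andP[/eqP-> _].
exists (Re c + 1) => [|x]; first by rewrite ltr_wpDl// -lecR -cE.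
have := cA x; rewrite cE !normE_hnorm -rmorphM lecR => /le_trans; apply.
by rewrite ler_wpM2r ?hnorm_ge0// lerDl.
Qed.

Lemma bounded_op_hnorm (f : H -> H) (c : R) : linear f ->
  0 <= c -> (forall x, hnorm (f x) <= c * hnorm x) -> f \in @bounded_op R H.
Proof.
move=> lf c0 cf; apply/bounded_opP; split=> //.
by exists c%:C => [|x]; rewrite ?lecR// !normE_hnorm -rmorphM lecR.
Qed.

(** For c > 0 this is the hypothesis of Lax-Milgram; c of any sign serves as a lower bound of the
    numerical range. *)
Definition coercive c A := forall x, c * rdot x x <= rdot (A x) x.

Lemma coercive_hnorm c A x : coercive c A -> c * hnorm x <= hnorm (A x).
Proof.
move=> cA; have [x0|x0] := eqVneq (hnorm x) 0; first by rewrite x0 mulr0 hnorm_ge0.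
have {}x0 : 0 < hnorm x by rewrite lt_neqAle eq_sym x0 hnorm_ge0.
rewrite -(ler_pM2r x0) -mulrA -expr2 hnorm_sqr.
exact: le_trans (cA x) (rdot_le_hnorm _ _).
Qed.

(* The Richardson iteration x - t (A x - y), whose fixed point solves A x = y, is
   a contraction for t = c / K ^ 2. *)
Lemma hnorm_richardson c A K x : 0 < c -> c <= K -> coercive c A ->
  (forall x, hnorm (A x) <= K * hnorm x) ->
  hnorm (x - (c / K ^+ 2)%:C *: A x) <= (1 - (c / K) ^+ 2 / 2) * hnorm x.
Proof.
move=> c0 cK cA KA; have K0 : 0 < K by exact: lt_le_trans cK.
set s := (c / K) ^+ 2.
have s1 : s <= 1.
  by rewrite expr_le1 ?divr_ge0 ?(ltW c0) ?(ltW K0)// ler_pdivrMr ?mul1r.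
have s0 : 0 <= s by rewrite sqr_ge0.
rewrite -(@ler_pXn2r _ 2)// ?nnegrE ?mulr_ge0 ?hnorm_ge0//; last by lra.
rewrite exprMn !hnorm_sqr rdotDl !rdotDr !rdotNl !rdotNr !rdotZl !rdotZr (rdotC x).
have h1 := cA x; have h2 : rdot (A x) (A x) <= K ^+ 2 * rdot x x.
  by rewrite -!hnorm_sqr -exprMn ler_sqr ?nnegrE ?mulr_ge0 ?hnorm_ge0// ltW.
set t := c / K ^+ 2; have t0 : 0 <= t by rewrite divr_ge0 ?sqr_ge0// ltW.
have st : s = t * c by rewrite /s /t; field; rewrite lt0r_neq0.
have st2 : s = t ^+ 2 * K ^+ 2 by rewrite /s /t; field; rewrite lt0r_neq0.
have h3 : t ^+ 2 * rdot (A x) (A x) <= s * rdot x x.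
  by rewrite st2 -mulrA ler_wpM2l ?sqr_ge0.
have h4 : s * rdot x x <= t * rdot (A x) x by rewrite st -mulrA ler_wpM2l.
have : 0 <= s ^+ 2 * rdot x x by rewrite mulr_ge0 ?rdotxx_ge0// sqr_ge0.
lra.
Qed.

(** The Lax-Milgram argument: the Richardson iterates from 0 form a Cauchy sequence by comparison
    with a geometric series of ratio q, and their limit solves the equation. *)
Lemma coercive_surj c A y : 0 < c -> coercive c A -> exists x, A x = y.
Proof.
move=> c0 cA; have [K' K'0 K'A] := bop_bound A.
(* Adding c ensures c <= K, which makes q lie in [0, 1). *)
pose K := K' + c; have cK : c <= K by rewrite lerDr ltW.
have KA x : hnorm (A x) <= K * hnorm x.
  by rewrite (le_trans (K'A x))// ler_wpM2r ?hnorm_ge0// lerDl ltW.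
have K0 : 0 < K by exact: lt_le_trans cK.
pose t := c / K ^+ 2; have t0 : 0 < t by rewrite divr_gt0// exprn_gt0.
pose q := 1 - (c / K) ^+ 2 / 2.
have s1 : (c / K) ^+ 2 <= 1.
  by rewrite expr_le1 ?divr_ge0 ?(ltW c0) ?(ltW K0)// ler_pdivrMr ?mul1r.
have s0 : 0 < (c / K) ^+ 2 by rewrite exprn_gt0 ?divr_gt0.
have q0 : 0 <= q by rewrite /q; lra.
have q1 : q < 1 by rewrite /q; lra.
pose F x := x - t%:C *: (A x - y).
have subACA (a b c' d : H) : (a - b) - (c' - d) = (a - c') - (b - d).
  by rewrite opprD addrACA -opprD.
have FB a b : F a - F b = (a - b) - t%:C *: A (a - b).
  by rewrite /F subACA -scalerBr subACA subrr subr0 -linearB.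
pose u n := iter n F 0.
pose d := hnorm (t%:C *: y).
have uS n : hnorm (u n.+1 - u n) <= q ^+ n * d.
  elim: n => [|n IH].
    by rewrite expr0 mul1r /u /= subr0 /F linear0 !sub0r scalerN opprK.
  have -> : u n.+2 - u n.+1 = (u n.+1 - u n) - t%:C *: A (u n.+1 - u n).
    exact: FB.
  rewrite (le_trans (hnorm_richardson _ c0 cK cA KA))// -/q exprS -mulrA.
  exact: ler_wpM2l.
pose D := d / (1 - q).
have D0 : 0 <= D by rewrite divr_ge0 ?hnorm_ge0// subr_ge0 ltW.
(* Sum of k terms of the geometric series; the factor 1 - q^k is what makes the induction close. *)
have uD n k : hnorm (u (n + k)%N - u n) <= q ^+ n * D * (1 - q ^+ k).
  elim: k => [|k IH]; first by rewrite addn0 subrr hnorm0 expr0 subrr mulr0.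
  rewrite addnS (le_trans (hnorm_dist (u (n + k)%N) _ _))//.
  apply: le_trans (lerD (uS _) IH) _.
  have -> : d = D * (1 - q) by rewrite /D; field; lra.
  rewrite exprS exprD; lra.
have uD' n k : hnorm (u (n + k)%N - u n) <= q ^+ n * D.
  rewrite (le_trans (uD n k))// ler_piMr ?gerBl ?exprn_ge0//.
  by rewrite mulr_ge0// exprn_ge0.
have qlim (e : R) : 0 < e -> exists N, forall n, (N <= n)%N -> q ^+ n <= e.
  move=> e0; have /cvg_expr/cvgrPdist_lt/(_ e e0)[N _ NP] : `|q| < 1 by rewrite ger0_norm.
  exists N => n /NP /=; rewrite sub0r normrN => /ltW.
  by apply: le_trans; exact: ler_norm.
have [e e0|l ul] := @hilbert_complete R H u.
  have D1 : 0 < D + 1 by lra.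
  have [|N NP] := qlim (e / (2 * (D + 1))); first by rewrite divr_gt0// mulr_gt0.
  exists N => m n Nm Nn; rewrite (le_trans (hnorm_dist (u N) _ _))//.
  have h k : (N <= k)%N -> hnorm (u k - u N) <= e / 2.
    move=> /subnKC <-; rewrite (le_trans (uD' _ _))//.
    rewrite (@le_trans _ _ (e / (2 * (D + 1)) * (D + 1)))//.
      by rewrite ler_pM// ?exprn_ge0 ?NP// lerDl.
    by rewrite le_eqVlt; apply/orP; left; apply/eqP; field; rewrite lt0r_neq0.
  by rewrite (hnormBC (u N)) [leRHS]splitr lerD ?h.
(* A l - y is split at A (u n): the first gap is small because A is bounded, the second has the norm
   of u (n + 1) - u n divided by t. *)
exists l; apply/eqP; rewrite -subr_eq0; apply/eqP/hnorm_eq0/eqP.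
rewrite eq_le hnorm_ge0 andbT; apply/ler_addgt0Pr => e e0; rewrite add0r.
have [|N NP] := ul (e / (2 * K)); first by rewrite divr_gt0// mulr_gt0.
have d1 : 0 < d + 1 by have := hnorm_ge0 (t%:C *: y); rewrite -/d; lra.
have [|M MP] := qlim (e * t / (2 * (d + 1))).
  by apply: divr_gt0; apply: mulr_gt0.
pose n := maxn N M.
rewrite (le_trans (hnorm_dist (A (u n)) _ _))// [leRHS]splitr lerD//.
  rewrite -linearB (le_trans (KA _))// hnormBC.
  rewrite (le_trans (ler_wpM2l (ltW K0) (NP n _)))// ?leq_maxl//.
  by rewrite le_eqVlt; apply/orP; left; apply/eqP; field; rewrite lt0r_neq0.
have : t * hnorm (A (u n) - y) <= t * (e / 2).
  have -> : t * hnorm (A (u n) - y) = hnorm (u n.+1 - u n).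
    rewrite /= -/(u n) /F addrAC subrr sub0r hnormN hnormZ ger0_norm// ltW//.
  rewrite (le_trans (uS n))// (@le_trans _ _ (e * t / (2 * (d + 1)) * (d + 1)))//.
    by rewrite ler_pM// ?exprn_ge0 ?hnorm_ge0 ?MP ?leq_maxr// lerDl.
  by rewrite le_eqVlt; apply/orP; left; apply/eqP; field; rewrite lt0r_neq0.
by rewrite ler_pM2l.
Qed.

Lemma coercive_inj c A x : 0 < c -> coercive c A -> A x = 0 -> x = 0.
Proof.
move=> c0 cA Ax; apply/hnorm_eq0/eqP; rewrite eq_le hnorm_ge0 andbT.
by rewrite -(ler_pM2l c0) mulr0 -(hnorm0 (H := H)) -Ax; exact: coercive_hnorm.
Qed.

(** Preimages are chosen pointwise; injectivity makes the choice linear, and coercivity bounds it by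
    1 / c. *)
Lemma coercive_invertible c A : 0 < c -> coercive c A -> invertible_op A.
Proof.
move=> c0 cA.
have [g gP] := choice (fun y => coercive_surj y c0 cA).
have Ainj x y : A x = A y -> x = y.
  move=> xy; apply/eqP; rewrite -subr_eq0; apply/eqP/(coercive_inj c0 cA).
  by rewrite linearB /= xy subrr.
have lg : linear g.
  by move=> a x y; apply: Ainj; rewrite linearP /= !gP.
have bg : g \in @bounded_op R H.
  apply: (@bounded_op_hnorm _ c^-1) => // [|x]; first by rewrite invr_ge0 ltW.
  by rewrite ler_pdivlMl// -{2}(gP x); exact: coercive_hnorm.
exists (Bop bg); split; apply: bopP => x; rewrite !bopE /= ?gP//.
by apply: Ainj; rewrite gP.
Qed.

End Operators.

(** * Polynomials of a self-adjoint operator *)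

Section Polynomials.
Context {R : realType} {H : hilbertType R}.
Implicit Types (A B S T : bop H) (x y : H) (r c : R) (p q : {poly R}).
Implicit Types (P Q : {poly R[i]}).

(** Complex coefficients are allowed so that a polynomial splits into linear factors. *)
Definition cpoly P A : bop H := \sum_(i < size P) P`_i *: A ^+ i.

Lemma cpoly_wide n P A : (size P <= n)%N -> cpoly P A = \sum_(i < n) P`_i *: A ^+ i.
Proof.
move=> Pn; rewrite /cpoly (big_ord_widen n (fun i => P`_i *: A ^+ i))//.
rewrite big_mkcond; apply: eq_bigr => i _; case: ifPn => //.
by rewrite -leqNgt => /leq_sizeP/(_ i (leqnn _)) ->; rewrite scale0r.
Qed.

Lemma cpolyD P Q A : cpoly (P + Q) A = cpoly P A + cpoly Q A.
Proof.
rewrite (cpoly_wide A (size_polyD P Q)) (cpoly_wide A (leq_maxl (size P) (size Q))).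
rewrite (cpoly_wide A (leq_maxr (size P) (size Q))) -big_split/=.
by apply: eq_bigr => i _; rewrite coefD scalerDl.
Qed.

Lemma cpolyZ a P A : cpoly (a *: P) A = a *: cpoly P A.
Proof.
rewrite (cpoly_wide A (size_scale_leq a P)) /cpoly scaler_sumr.
by apply: eq_bigr => i _; rewrite coefZ scalerA.
Qed.

Lemma cpolyC a A : cpoly a%:P A = a *: (1 : bop H).
Proof.
by rewrite (cpoly_wide A (size_polyC_leq1 a)) big_ord1 coefC eqxx expr0.
Qed.

Lemma cpolyMX P A : cpoly (P * 'X) A = cpoly P A * A.
Proof.
rewrite (@cpoly_wide (size P).+1) ?size_polyMleq; last first.
  by rewrite (leq_trans (size_polyMleq _ _))// size_polyX addnC.
rewrite big_ord_recl coefMX eqxx scale0r add0r /cpoly mulr_suml.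
by apply: eq_bigr => i _; rewrite coefMX /= bop_scalerAl -exprSr.
Qed.

Lemma cpoly0 A : cpoly 0 A = 0.
Proof. by rewrite /cpoly size_poly0 big_ord0. Qed.

Lemma cpolyX A : cpoly 'X A = A.
Proof. by rewrite -['X]mul1r cpolyMX cpolyC scale1r mul1r. Qed.

Lemma cpolyM P Q A : cpoly (P * Q) A = cpoly P A * cpoly Q A.
Proof.
elim/poly_ind: Q => [|Q a IH]; first by rewrite mulr0 cpoly0 mulr0.
rewrite mulrDr mulrA !cpolyD !cpolyMX IH mulrDr mulrA; congr (_ + _).
by rewrite mulrC mul_polyC cpolyZ cpolyC bop_scalerAr mulr1.
Qed.

Lemma op_polyE p A : op_poly p A = cpoly (map_poly (real_complex R) p) A.
Proof.
rewrite /op_poly /cpoly size_map_poly.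
by apply: eq_bigr => i _; rewrite coef_map.
Qed.

Lemma op_polyD p q A : op_poly (p + q) A = op_poly p A + op_poly q A.
Proof. by rewrite !op_polyE rmorphD cpolyD. Qed.

Lemma op_polyM p q A : op_poly (p * q) A = op_poly p A * op_poly q A.
Proof. by rewrite !op_polyE rmorphM cpolyM. Qed.

Lemma op_polyC c A : op_poly c%:P A = c%:C *: (1 : bop H).
Proof. by rewrite op_polyE map_polyC cpolyC. Qed.

Lemma op_polyX A : op_poly 'X A = A.
Proof. by rewrite op_polyE map_polyX cpolyX. Qed.

Lemma op_polyN p A : op_poly (- p) A = - op_poly p A.
Proof. by rewrite -mulN1r op_polyM -polyCN op_polyC rmorphN scaleNr scale1r mulN1r. Qed.

Lemma op_polyB p q A : op_poly (p - q) A = op_poly p A - op_poly q A.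
Proof. by rewrite op_polyD op_polyN. Qed.

Lemma op_poly_sym p A : sym_op A -> sym_op (op_poly p A).
Proof.
move=> sA; rewrite /op_poly.
elim/big_ind: _ => [||i _]; [exact: sym_op0|by move=> *; exact: sym_opD|].
by apply: sym_opZ; exact: sym_opX.
Qed.

Lemma invertible1 : invertible_op (1 : bop H).
Proof. by exists 1; rewrite mulr1. Qed.

Lemma invertibleM A B : invertible_op A -> invertible_op B -> invertible_op (A * B).
Proof.
move=> [A' [AA' A'A]] [B' [BB' B'B]]; exists (B' * A'); split.
  by rewrite -mulrA (mulrA B) BB' mul1r.
by rewrite -mulrA (mulrA A') A'A mul1r.
Qed.

(** An inverse C of the product gives A the left inverse C B and the right inverse B C, which must
    then coincide. *)
Lemma invertible_factor A B : A * B = B * A -> invertible_op (A * B) -> invertible_op A.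
Proof.
move=> AB [C [ABC CAB]].
have CB : C * B * A = 1 by rewrite -mulrA -AB.
have BC : A * (B * C) = 1 by rewrite mulrA.
exists (B * C); split=> //; suff -> : B * C = C * B by [].
by rewrite -[LHS]mul1r -CB -[LHS]mulrA BC mulr1.
Qed.

Lemma invertibleZ1 (a : R[i]) : a != 0 -> invertible_op (a *: (1 : bop H)).
Proof.
move=> a0; exists (a^-1 *: (1 : bop H)); rewrite !bop_scalerAl !mul1r !scalerA.
by rewrite mulfV// mulVf// scale1r.
Qed.

(** For z = a + i b and S = A - a, the product (S - i b)(S + i b) = S^2 + b^2 is coercive with
    constant b^2. *)
Lemma sym_nonreal_invertible A (z : R[i]) : sym_op A -> Im z != 0 ->
  invertible_op (A - z *: (1 : bop H)).
Proof.
case: z => a b sA /= b0.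
have -> : (a +i* b) = a%:C + b%:C * 'i by simpc.
pose S := A - a%:C *: (1 : bop H).
have sS : sym_op S by apply: sym_opB => //; apply: sym_opZ; exact: sym_op1.
have -> : A - (a%:C + b%:C * 'i) *: (1 : bop H) = S - (b%:C * 'i) *: (1 : bop H).
  by rewrite scalerDl opprD addrA.
move: S sS => {sA}S sS.
apply: (@invertible_factor _ (S + (b%:C * 'i) *: (1 : bop H))).
  have cS (w : R[i]) : GRing.comm S (w *: (1 : bop H)).
    by rewrite /GRing.comm bop_scalerAl bop_scalerAr mul1r mulr1.
  by apply: commrD; apply/commr_sym/commrB => //; exact: commr_sym.
have b2 : 0 < b ^+ 2 by rewrite lt_neqAle eq_sym sqrf_eq0 b0 sqr_ge0.
apply: (@coercive_invertible _ _ (b ^+ 2)) => // x.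
have -> : (S - (b%:C * 'i) *: (1 : bop H)) * (S + (b%:C * 'i) *: (1 : bop H)) =
    S * S + (b ^+ 2)%:C *: (1 : bop H).
  rewrite mulrBl !mulrDr !bop_scalerAl !bop_scalerAr !mul1r !mulr1.
  rewrite opprD addrA addrK scalerA.
  by congr (_ + _); rewrite -scaleNr; congr (_ *: _); simpc; congr (_ +i* _); ring.
by rewrite !bopE rdotDl rdotZl sS lerDr rdotxx_ge0.
Qed.

Lemma prod_root_invertible (s : seq R[i]) A :
  (forall z, z \in s -> invertible_op (A - z *: (1 : bop H))) ->
  invertible_op (cpoly (\prod_(z <- s) ('X - z%:P)) A).
Proof.
elim: s => [_|z s IH sA]; first by rewrite big_nil cpolyC scale1r; exact: invertible1.
rewrite big_cons cpolyM; apply: invertibleM.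
  rewrite -polyCN cpolyD cpolyX cpolyC scaleNr; apply: sA; exact: mem_head.
by apply: IH => w ws; apply: sA; rewrite in_cons ws orbT.
Qed.

(* When p = c the claim would need the spectrum of A to be nonempty. *)
Lemma spectral_mapping p A c : sym_op A -> p != c%:P ->
  spectrum (op_poly p A) c%:C -> exists2 t, spectrum A t%:C & p.[t] = c.
Proof.
move=> sA pc; pose Q := map_poly (real_complex R) (p - c%:P).
have Q0 : Q != 0 by rewrite map_poly_eq0 subr_eq0.
have -> : spectrum (op_poly p A) c%:C = ~ invertible_op (cpoly Q A).
  by rewrite -op_polyE op_polyB op_polyC.
have [s sQ] := closed_field_poly_normal Q.
(* If c is not attained on the spectrum, every linear factor of p - c is invertible at A: nonreal
   roots by symmetry, real roots because they satisfy p = c. *)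
move=> nQ; apply: contrapT => nt; apply: nQ; rewrite sQ cpolyZ.
rewrite -[cpoly _ _]mul1r -bop_scalerAl; apply: invertibleM.
  by apply: invertibleZ1; rewrite lead_coef_eq0.
apply: prod_root_invertible => z zs.
have [zr|] := eqVneq (Im z) 0; last exact: sym_nonreal_invertible.
have zE : z = (Re z)%:C by move: zr; case: (z) => a b /= ->.
apply: contrapT => nz; apply: nt; exists (Re z); first by rewrite -zE.
have : root Q z by rewrite sQ rootZ ?lead_coef_eq0// root_prod_XsubC.
rewrite /root zE horner_map fmorph_eq0 !hornerE subr_eq0 => /eqP //.
Qed.

(** With |x| <= L |S x| from the inverse, it is enough to bound |S x|^2 by K <S x, x>. *)
Lemma pos_invertible_coercive S : sym_op S -> (forall x, 0 <= rdot (S x) x) ->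
  invertible_op S -> exists2 d, 0 < d & coercive d S.
Proof.
move=> sS S0 [T [ST TS]].
have [K K0 SK] := bop_bound S; have [L L0 TL] := bop_bound T.
exists (K * L ^+ 2)^-1 => [|x]; first by rewrite invr_gt0 mulr_gt0 ?exprn_gt0.
rewrite ler_pdivrMl ?mulr_gt0 ?exprn_gt0//.
have h1 : rdot x x <= L ^+ 2 * rdot (S x) (S x).
  rewrite -!hnorm_sqr -exprMn ler_pXn2r ?nnegrE ?mulr_ge0 ?hnorm_ge0 ?(ltW L0)//.
  by rewrite -[X in hnorm X]/((1 : bop H) x) -TS TL.
have h2 : rdot (S (S x)) (S x) <= K * rdot (S x) (S x).
  rewrite (le_trans (rdot_le_hnorm _ _))// -hnorm_sqr expr2 mulrA.
  by rewrite ler_wpM2r ?hnorm_ge0.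
(* Positivity at this vector, with S bounded by K, gives |S x|^2 <= K <S x, x>. *)
have := S0 (x - K^-1%:C *: S x).
rewrite linearB linearZ /= rdotDl !rdotDr !rdotNl !rdotNr !rdotZl !rdotZr.
rewrite (sS (S x) x) opprK => h3.
have h4 : K^-1 * (K^-1 * rdot (S (S x)) (S x)) <= K^-1 * rdot (S x) (S x).
  by rewrite ler_wpM2l ?invr_ge0 ?(ltW K0)// ler_pdivrMl.
have h5 : rdot (S x) (S x) <= K * rdot (S x) x.
  rewrite -ler_pdivrMl//; lra.
rewrite (le_trans h1)// (mulrC K) -[leRHS]mulrA ler_wpM2l ?sqr_ge0//.
Qed.

(** The point c is the largest coercivity constant of S: were S - c invertible, it would be coercive
    and c could be increased. The nonzero [x0] bounds the set of constants from above. *)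
Lemma spectrum_bottom S x0 : sym_op S -> x0 != 0 ->
  exists2 c, spectrum S c%:C & coercive c S.
Proof.
move=> sS x00.
have [K K0 SK] := bop_bound S.
have quadK x : `|rdot (S x) x| <= K * rdot x x.
  rewrite (le_trans (normr_rdot_le_hnorm _ _))// -hnorm_sqr expr2 mulrA.
  by rewrite ler_wpM2r ?hnorm_ge0.
pose E := [set c | coercive c S].
have pos x : x != 0 -> 0 < rdot x x.
  move=> xn0; rewrite lt_neqAle rdotxx_ge0 andbT eq_sym -hnorm_sqr sqrf_eq0.
  by apply: contra_neq xn0; exact: hnorm_eq0.
have Eub x : x != 0 -> ubound E (rdot (S x) x / rdot x x).
  by move=> /pos xn0 c /(_ x); rewrite ler_pdivlMr.
have E0 : E (- K).
  by move=> x; have := quadK x; rewrite ler_norml mulNr => /andP[].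
have supE : has_sup E.
  by split; [exists (- K)|exists (rdot (S x0) x0 / rdot x0 x0); exact: Eub].
have cS : coercive (sup E) S.
  move=> x; have [->|xn0] := eqVneq x 0; first by rewrite !rdot0r mulr0.
  by rewrite -ler_pdivlMr ?pos//; apply: ge_sup; [case: supE|exact: Eub].
exists (sup E) => // iS.
have qE d x : rdot ((S - d%:C *: (1 : bop H)) x) x = rdot (S x) x - d * rdot x x.
  by rewrite !bopE rdotDl rdotNl rdotZl.
have [||d d0 dS] := @pos_invertible_coercive (S - (sup E)%:C *: (1 : bop H)) _ _ iS.
- by apply: sym_opB => //; apply: sym_opZ; exact: sym_op1.
- by move=> x; rewrite qE subr_ge0.
have : E (sup E + d) by move=> x; have := dS x; rewrite qE; lra.
by move/(ub_le_sup (proj2 supE)); lra.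
Qed.

Lemma op_poly_ge0 p A : sym_op A -> (forall t, spectrum A t%:C -> 0 <= p.[t]) ->
  forall x, 0 <= rdot (op_poly p A x) x.
Proof.
move=> sA pA x; have [->|xn0] := eqVneq x 0; first by rewrite rdot0r.
have [c cS cp] := spectrum_bottom (op_poly_sym p sA) xn0.
(* This point of the spectrum of A serves the case where p is the constant c, which the spectral
   mapping leaves out. *)
have [t tA _] := spectrum_bottom sA xn0.
apply: le_trans (cp x); rewrite mulr_ge0 ?rdotxx_ge0//.
have [pc|/(spectral_mapping sA)/(_ cS)[t' /pA + <-//]] := eqVneq p c%:P.
by have := pA _ tA; rewrite pc hornerC.
Qed.

(** Positivity is applied to the polynomial e^2 - p^2. *)
Lemma op_poly_hnorm p A e : sym_op A -> 0 <= e ->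
  (forall t, spectrum A t%:C -> `|p.[t]| <= e) ->
  forall x, hnorm (op_poly p A x) <= e * hnorm x.
Proof.
move=> sA e0 pA x.
rewrite -(@ler_pXn2r _ 2)// ?nnegrE ?mulr_ge0 ?hnorm_ge0// exprMn !hnorm_sqr.
have := @op_poly_ge0 ((e ^+ 2)%:P - p * p) _ sA _ x.
rewrite op_polyB op_polyM op_polyC !bopE rdotDl rdotNl rdotZl.
rewrite (op_poly_sym p sA) subr_ge0; apply => t /pA.
by rewrite !hornerE -expr2 subr_ge0 -[p.[t] ^+ 2]real_normK ?num_real// ler_sqr ?nnegrE.
Qed.

End Polynomials.

(** * Continuous functional calculus *)

Lemma ler_addgt0_mulr (R : realType) (a b K : R) : 0 <= K ->
  (forall e, 0 < e -> a <= b + e * K) -> a <= b.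
Proof.
move=> K0 ab; apply/ler_addgt0Pr => e e0.
have K1 : 0 < K + 1 by lra.
apply: le_trans (ab (e / (K + 1)) (divr_gt0 e0 K1)) _.
rewrite lerD2l mulrAC ler_pdivrMr// ler_wpM2l ?(ltW e0)//; lra.
Qed.

Lemma invSn_lt (R : realType) (e : R) : 0 < e ->
  exists N, forall n, (N <= n)%N -> n.+1%:R^-1 < e.
Proof.
move=> e0; exists (Num.bound e^-1) => n Nn.
rewrite invf_plt ?posrE//.
have ei0 : 0 <= e^-1 by rewrite invr_ge0 ltW.
rewrite (lt_le_trans (archi_boundP ei0))// ler_nat.
exact: leq_trans Nn (leqnSn _).
Qed.

Section FunctionalCalculus.
Context {R : realType} {H : hilbertType R}.
Implicit Types (A B S T U : bop H) (x y : H) (f g : R -> R) (p q : {poly R}).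

Lemma bop_hnorm_unit_ball T (e : R) :
  (forall x, `|x| <= 1 -> hnorm (T x) <= e) -> forall x, hnorm (T x) <= e * hnorm x.
Proof.
move=> Te x; have [x0|xn0] := eqVneq (hnorm x) 0.
  by rewrite (hnorm_eq0 x0) linear0 hnorm0 mulr0.
have x_gt0 : 0 < hnorm x by rewrite lt_neqAle eq_sym xn0 hnorm_ge0.
have := Te ((hnorm x)^-1%:C *: x).
rewrite normE_hnorm !linearZ /= !hnormZ ger0_norm ?invr_ge0 ?hnorm_ge0//.
rewrite mulVf// lexx => /(_ isT).
by rewrite ler_pdivrMl// mulrC.
Qed.

(** Sequences and uniform filters give way to a single polynomial for each error; homogeneity turns
    the bound on the unit ball into an operator bound, and conversely the errors 1 / (n + 1) yield a
    sequence. *)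
Lemma is_cfcP f A T : is_cfc f A T <->
  forall e : R, 0 < e -> exists p : {poly R},
    (forall t, spectrum A t%:C -> `|p.[t] - f t| <= e) /\
    forall x, hnorm (op_poly p A x - T x) <= e * hnorm x.
Proof.
split=> [[p [pf pT]] e e0|P].
- have /pf[N _ Nf] : nbhs (f : {uniform` [set t | spectrum A t%:C] -> R})
      [set h | forall t, spectrum A t%:C -> `|f t - h t| < e].
    apply/uniform_nbhs; exists [set z : R * R | `|z.1 - z.2| < e]; split=> //.
    by rewrite -entourage_ballE; exists e.
  have /pT[M _ MT] : nbhs ((T : H -> H) : {uniform` [set x : H | `|x| <= 1] -> H})
      [set h | forall x, `|x| <= 1 -> `|T x - h x| < e%:C].
    apply/uniform_nbhs; exists [set z : H * H | `|z.1 - z.2| < e%:C]; split=> //.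
    rewrite -entourage_ballE; exists e%:C => /=; first by rewrite ltcR.
    by rewrite -ball_normE.
  exists (p (maxn N M)); split=> [t tA|x].
    by rewrite distrC ltW//; apply: Nf tA => /=; rewrite leq_maxl.
  have := @bop_hnorm_unit_ball (op_poly (p (maxn N M)) A - T) e _ x.
  rewrite !bopE; apply => {}x x1.
  rewrite !bopE hnormBC -lecR -normE_hnorm ltW//; apply: MT x1 => /=; exact: leq_maxr.
- have e0 n : 0 < n.+1%:R^-1 :> R by rewrite invr_gt0.
  have [p pP] := choice (fun n => P _ (e0 n)).
  exists p; split.
  + move=> Q /uniform_nbhs[E [+ EQ]]; rewrite -entourage_ballE => -[e /= e1 eE].
    have [N NP] := invSn_lt e1; exists N => //= n Nn; apply: EQ => t tA /=.
    apply: eE; rewrite /ball /= distrC (le_lt_trans (proj1 (pP n) t tA))//.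
    exact: NP.
  + move=> Q /uniform_nbhs[E [+ EQ]]; rewrite -entourage_ballE => -[e /= e1 eE].
    have eE' : e = (Re e)%:C.
      by move: e1; case: (e) => a b; rewrite ltcE /= => /andP[/eqP-> _].
    have /invSn_lt[N NP] : 0 < Re e by rewrite -ltcR -eE'.
    exists N => //= n Nn; apply: EQ => x /= x1.
    apply: eE; rewrite -ball_normE /= normE_hnorm eE' ltcR hnormBC.
    rewrite (le_lt_trans (proj2 (pP n) x))// (le_lt_trans _ (NP _ Nn))//.
    by rewrite ler_piMr ?invr_ge0// -lecR -normE_hnorm.
Qed.

Lemma is_cfc_poly p A : is_cfc (horner p) A (op_poly p A).
Proof.
apply/is_cfcP => e e0; exists p; split=> [t _|x].
  by rewrite subrr normr0 ltW.
by rewrite subrr hnorm0 mulr_ge0 ?hnorm_ge0 ?ltW.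
Qed.

Lemma eq_is_cfc f g A T : (forall t, spectrum A t%:C -> f t = g t) ->
  is_cfc f A T -> is_cfc g A T.
Proof.
move=> fg /is_cfcP fT; apply/is_cfcP => e /fT[p [pf pT]].
by exists p; split=> // t tA; rewrite -fg ?pf.
Qed.

(** Polynomials d-close to f and g differ by at most e + 2 d on the spectrum, hence so do their
    values at A in norm. Uniqueness, existence and continuity of the calculus all rest on this
    estimate. *)
Lemma is_cfc_dist f g A T U (e : R) : sym_op A -> 0 <= e ->
  is_cfc f A T -> is_cfc g A U ->
  (forall t, spectrum A t%:C -> `|f t - g t| <= e) ->
  forall x, hnorm (T x - U x) <= e * hnorm x.
Proof.
move=> sA e0 /is_cfcP fT /is_cfcP gU fg x.
apply: (@ler_addgt0_mulr _ _ _ (4 * hnorm x)) => [|d d0].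
  by rewrite mulr_ge0 ?hnorm_ge0.
have [p [pf pT]] := fT _ d0; have [q [qg qU]] := gU _ d0.
have pq : hnorm (op_poly (p - q) A x) <= (e + 2 * d) * hnorm x.
  apply: op_poly_hnorm => // [|t tA]; first lra.
  rewrite !hornerE; have h1 := pf _ tA; have h2 := qg _ tA; have h3 := fg _ tA.
  move: h1 h2 h3; rewrite !ler_norml; lra.
move: pq; rewrite op_polyB !bopE => pq.
apply: le_trans (hnorm_dist (op_poly p A x) _ _) _.
have := hnorm_dist (op_poly q A x) (op_poly p A x) (U x).
have := pT x; have := qU x; rewrite (hnormBC (T x)); lra.
Qed.

Lemma is_cfc_unique f A T U : sym_op A -> is_cfc f A T -> is_cfc f A U -> T = U.
Proof.
move=> sA fT fU; apply: bopP => x; apply/eqP; rewrite -subr_eq0; apply/eqP/hnorm_eq0/eqP.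
rewrite eq_le hnorm_ge0 andbT -[leRHS](mul0r (hnorm x)).
by apply: is_cfc_dist fT fU _ x => // t _; rewrite subrr normr0.
Qed.

Lemma cfcE f A T : sym_op A -> is_cfc f A T -> cfc f A = T.
Proof.
move=> sA fT; apply: (is_cfc_unique sA _ fT).
by apply: xgetPex; exists T.
Qed.

Lemma is_cfc_sym f A T : sym_op A -> is_cfc f A T -> sym_op T.
Proof.
move=> sA /is_cfcP fT x y; apply/eqP; rewrite -subr_eq0 -normr_le0.
apply: (@ler_addgt0_mulr _ _ _ (2 * (hnorm x * hnorm y))) => [|d d0].
  by rewrite !mulr_ge0 ?hnorm_ge0.
have [p [_ pT]] := fT _ d0; have sp := op_poly_sym p sA.
have -> : rdot (T x) y - rdot x (T y) =
  rdot x (op_poly p A y - T y) - rdot (op_poly p A x - T x) y.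
  by rewrite rdotDl rdotNl rdotDr rdotNr sp; ring.
rewrite (le_trans (ler_normB _ _))// add0r.
have h1 := normr_rdot_le_hnorm x (op_poly p A y - T y).
have h2 := normr_rdot_le_hnorm (op_poly p A x - T x) y.
have h3 := ler_wpM2l (hnorm_ge0 x) (pT y); have h4 := ler_wpM2r (hnorm_ge0 y) (pT x).
lra.
Qed.

Lemma is_cfc_le f g A T U : sym_op A -> is_cfc f A T -> is_cfc g A U ->
  (forall t, spectrum A t%:C -> f t <= g t) ->
  forall x, rdot (T x) x <= rdot (U x) x.
Proof.
move=> sA /is_cfcP fT /is_cfcP gU fg x.
apply: (@ler_addgt0_mulr _ _ _ (4 * (hnorm x ^+ 2))) => [|d d0].
  by rewrite mulr_ge0 ?sqr_ge0.
have [p [pf pT]] := fT _ d0; have [q [qg qU]] := gU _ d0.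
(* The constant 2 d offsets both approximation errors, so that this polynomial is nonnegative on the
   spectrum. *)
have := @op_poly_ge0 _ _ (q - p + (2 * d)%:P) A sA _ x.
rewrite op_polyD op_polyB op_polyC !bopE !rdotDl rdotNl rdotZl -hnorm_sqr.
move=> /(_ _)/wrap[].
  move=> t tA; rewrite !hornerE.
  have h1 := pf _ tA; have h2 := qg _ tA; have h3 := fg _ tA.
  by move: h1 h2; rewrite !ler_norml; lra.
have h1 := normr_rdot_le_hnorm (op_poly p A x - T x) x.
have h2 := normr_rdot_le_hnorm (op_poly q A x - U x) x.
have h3 := ler_wpM2r (hnorm_ge0 x) (pT x); have h4 := ler_wpM2r (hnorm_ge0 x) (qU x).
move: (le_trans h1 h3) (le_trans h2 h4).
rewrite !ler_norml !rdotDl !rdotNl -!mulrA -!expr2; lra.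
Qed.

Lemma is_cfcM f g A T U (F G : R) : sym_op A -> is_cfc f A T -> is_cfc g A U ->
  (forall t, spectrum A t%:C -> `|f t| <= F) ->
  (forall t, spectrum A t%:C -> `|g t| <= G) ->
  is_cfc (fun t => f t * g t) A (T * U).
Proof.
move=> sA /is_cfcP fT /is_cfcP gU fF gG; apply/is_cfcP => e e0.
have [K K0 UK] := bop_bound U.
(* Absolute values are taken because F and G may be negative when the spectrum has no real point. *)
pose F' := `|F|; pose G' := `|G|.
have F0 : 0 <= F' by exact: normr_ge0.
have G0 : 0 <= G' by exact: normr_ge0.
have {}fF t : spectrum A t%:C -> `|f t| <= F'.
  by move=> /fF/le_trans; apply; exact: ler_norm.
have {}gG t : spectrum A t%:C -> `|g t| <= G'.
  by move=> /gG/le_trans; apply; exact: ler_norm.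
pose s := F' + 1 + G' + K; have s0 : 0 < s by rewrite /s; lra.
(* This choice gives both d <= 1 and d s <= e; s collects the constants of the two estimates
   below. *)
pose d := e / (e + s).
have es0 : 0 < e + s by exact: addr_gt0.
have d0 : 0 < d by exact: divr_gt0.
have d1 : d <= 1 by rewrite ler_pdivrMr// mul1r lerDl ltW.
have ds : d * s <= e.
  by rewrite mulrAC ler_pdivrMr// ler_wpM2l ?(ltW e0)// lerDr ltW.
have [p [pf pT]] := fT _ d0; have [q [qg qU]] := gU _ d0.
have pF t : spectrum A t%:C -> `|p.[t]| <= F' + 1.
  by move=> tA; have := pf _ tA; have := fF _ tA; rewrite !ler_norml; lra.
exists (p * q); split=> [t tA|x].
  rewrite hornerM; have -> : p.[t] * q.[t] - f t * g t =
    p.[t] * (q.[t] - g t) + (p.[t] - f t) * g t by ring.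
  rewrite (le_trans (ler_normD _ _))// !normrM.
  have h1 := ler_pM (normr_ge0 _) (normr_ge0 _) (pF _ tA) (qg _ tA).
  have h2 := ler_pM (normr_ge0 _) (normr_ge0 _) (pf _ tA) (gG _ tA).
  have : 0 <= d * K by rewrite mulr_ge0 ?ltW.
  by move: ds; rewrite /s; lra.
rewrite op_polyM !bopE (le_trans (hnorm_dist (op_poly p A (U x)) _ _))//.
rewrite -linearB /=.
have h1 : hnorm (op_poly p A (op_poly q A x - U x)) <= (F' + 1) * (d * hnorm x).
  apply: (le_trans (op_poly_hnorm sA _ pF _)); first lra.
  by rewrite ler_wpM2l ?qU//; lra.
have h2 : hnorm (op_poly p A (U x) - T (U x)) <= d * (K * hnorm x).
  by rewrite (le_trans (pT _))// ler_wpM2l ?(ltW d0).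
have h3 := ler_wpM2r (hnorm_ge0 x) ds.
have h4 : 0 <= d * G' * hnorm x by rewrite mulr_ge0 ?hnorm_ge0// mulr_ge0// ltW.
by move: h3; rewrite /s; lra.
Qed.

Definition op_within (a b : R) A :=
  forall x, a * rdot x x <= rdot (A x) x <= b * rdot x x.

(** For t outside [a, b], either A - t or t - A is coercive. *)
Lemma spectrum_within a b A t : op_within a b A -> spectrum A t%:C -> a <= t <= b.
Proof.
move=> Aab tA; apply/andP; split; rewrite leNgt; apply/negP => lt; apply: tA.
  apply: (@coercive_invertible _ _ (a - t)); first by rewrite subr_gt0.
  by move=> x; rewrite !bopE rdotDl rdotNl rdotZl mulrBl lerD2r; case/andP: (Aab x).
have [C [AC CA]] : invertible_op (t%:C *: (1 : bop H) - A).
  apply: (@coercive_invertible _ _ (t - b)); first by rewrite subr_gt0.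
  by move=> x; rewrite !bopE rdotDl rdotNl rdotZl mulrBl lerD2l lerN2; case/andP: (Aab x).
by exists (- C); rewrite mulrN mulNr -[in X in X /\ _]mulNr -mulrN opprB.
Qed.

(** Pointwise limits exist by completeness of H; since the Cauchy estimate is uniform, linearity and
    boundedness pass from some [u N] to the limit. *)
Lemma op_complete (u : nat -> bop H) :
  (forall e : R, 0 < e -> exists N, forall m n, (N <= m)%N -> (N <= n)%N ->
    forall x, hnorm (u m x - u n x) <= e * hnorm x) ->
  exists T : bop H, forall e : R, 0 < e -> exists N, forall n, (N <= n)%N ->
    forall x, hnorm (u n x - T x) <= e * hnorm x.
Proof.
move=> uC.
have uCx x : forall e : R, 0 < e -> exists N, forall m n, (N <= m)%N -> (N <= n)%N ->
    hnorm (u m x - u n x) <= e.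
  move=> e e0; have x1 : 0 < hnorm x + 1 by have := hnorm_ge0 x; lra.
  have [N NP] := uC _ (divr_gt0 e0 x1).
  exists N => m n Nm Nn; apply: (le_trans (NP _ _ Nm Nn x)).
  by rewrite mulrAC ler_pdivrMr// ler_wpM2l ?(ltW e0)//; lra.
have [T0 T0P] := choice (fun x => hilbert_complete (uCx x)).
have uT (e : R) : 0 < e -> exists N, forall n, (N <= n)%N ->
    forall x, hnorm (u n x - T0 x) <= e * hnorm x.
  move=> e0; have [N NP] := uC _ e0; exists N => n Nn x.
  apply: (@ler_addgt0_mulr _ _ _ 1) => // d d0; rewrite mulr1.
  have [M MP] := T0P x d d0.
  apply: le_trans (hnorm_dist (u (maxn N M) x) _ _) _.
  by rewrite lerD ?NP ?MP ?leq_maxl ?leq_maxr.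
have lT : linear T0.
  move=> a x y; apply/eqP; rewrite -subr_eq0; apply/eqP/hnorm_eq0/eqP.
  rewrite eq_le hnorm_ge0 andbT.
  pose na := Num.sqrt (Re a ^+ 2 + Im a ^+ 2).
  have a0 : 0 <= na by exact: sqrtr_ge0.
  have Z z : hnorm (a *: z) = na * hnorm z.
    by apply: complexI; rewrite -normE_hnorm normrZ normc_def normE_hnorm -rmorphM.
  apply: (@ler_addgt0_mulr _ _ _ (hnorm (a *: x + y) + na * hnorm x + hnorm y)) => [|d d0].
    by rewrite addr_ge0 ?hnorm_ge0// addr_ge0 ?hnorm_ge0// mulr_ge0 ?hnorm_ge0.
  rewrite add0r; have [N NP] := uT d d0.
  have -> : T0 (a *: x + y) - (a *: T0 x + T0 y) =
     - (u N (a *: x + y) - T0 (a *: x + y)) + (a *: (u N x - T0 x) + (u N y - T0 y)).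
    have -> : a *: (u N x - T0 x) + (u N y - T0 y) =
       u N (a *: x + y) - (a *: T0 x + T0 y).
      by rewrite linearP /= scalerBr addrACA -opprD.
    by rewrite opprB addrA subrK.
  have h1 := NP N (leqnn _) (a *: x + y); have h2 := NP N (leqnn _) x.
  have h3 := NP N (leqnn _) y.
  apply: le_trans (hnormD _ _) _; rewrite hnormN.
  have := hnormD (a *: (u N x - T0 x)) (u N y - T0 y); rewrite Z.
  have := ler_wpM2l a0 h2; lra.
have [N NP] := uT 1 ltr01; have [K K0 uK] := bop_bound (u N).
have bT : T0 \in @bounded_op R H.
  apply: (@bounded_op_hnorm _ _ _ (1 + K)) => // [|x]; first by rewrite addr_ge0// ltW.
  have -> : T0 x = u N x - (u N x - T0 x) by rewrite subKr.
  apply: (le_trans (hnormD _ _)); rewrite hnormN mulrDl addrC lerD//.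
  exact: NP.
by exists (Bop bT).
Qed.

(** Existence of the calculus, so that [cfc] is not its default value 0: Weierstrass polynomials are
    uniformly Cauchy on the spectrum, hence their values at A converge in norm. *)
Lemma cfcP f A a b : sym_op A -> op_within a b A -> {in `[a, b], continuous f} ->
  is_cfc f A (cfc f A).
Proof.
move=> sA Aab cf; have W (e : R) : 0 < e ->
    exists p : {poly R}, forall t, spectrum A t%:C -> `|p.[t] - f t| <= e.
  move=> e0; have [p pf] := weierstrass e0 cf.
  by exists p => t /(spectrum_within Aab) tab; apply: pf; rewrite in_itv.
have e0 n : 0 < n.+1%:R^-1 :> R by rewrite invr_gt0.
have [p pP] := choice (fun n => W _ (e0 n)).
have [e e1|T TP] := @op_complete (fun n => op_poly (p n) A).
  have [|N NP] := @invSn_lt _ (e / 2); first by rewrite divr_gt0.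
  exists N => m n Nm Nn x.
  apply: is_cfc_dist (is_cfc_poly (p m) A) (is_cfc_poly (p n) A) _ x => //.
    exact: ltW.
  move=> t tA; have := pP m t tA; have := pP n t tA; have := NP _ Nm; have := NP _ Nn.
  move: (n.+1%:R^-1) (m.+1%:R^-1) => a1 a2; rewrite !ler_norml; lra.
suff fT : is_cfc f A T by rewrite (cfcE sA fT).
apply/is_cfcP => e e1; have [N NP] := TP _ e1; have [M MP] := invSn_lt e1.
exists (p (maxn N M)); split=> [t tA|x]; last by rewrite NP ?leq_maxl.
by rewrite (le_trans (pP _ t tA))// ltW// MP ?leq_maxr.
Qed.

End FunctionalCalculus.

(** * Functional calculus and intertwining maps *)

Lemma op_poly_intertwine (R : realType) (H K : hilbertType R) (A : bop H)
    (B : bop K) (X : {linear H -> K}) (p : {poly R}) :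
  (forall x, X (A x) = B (X x)) -> forall x, X (op_poly p A x) = op_poly p B (X x).
Proof.
move=> XA; elim/poly_ind: p => [|p c IH] x.
  by rewrite -polyC0 !op_polyC !bopE linearZ.
by rewrite !op_polyD !op_polyM !op_polyX !op_polyC !bopE linearD linearZ /= IH XA.
Qed.

(* Direct sums, restrictions and unitary equivalences are all of this form. *)
Lemma cfc_intertwine (R : realType) (H K : hilbertType R) (A : bop H)
    (B : bop K) (X : {linear H -> K}) (C : R) (f : R -> R) (a b : R) :
  sym_op A -> sym_op B -> op_within a b A -> op_within a b B ->
  {in `[a, b], continuous f} -> 0 <= C ->
  (forall x, hnorm (X x) <= C * hnorm x) -> (forall x, X (A x) = B (X x)) ->
  forall x, X (cfc f A x) = cfc f B (X x).
Proof.
move=> sA sB Aab Bab cf C0 XC XA x; apply/eqP; rewrite -subr_eq0; apply/eqP/hnorm_eq0/eqP.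
rewrite eq_le hnorm_ge0 andbT.
apply: (@ler_addgt0_mulr _ _ _ (C * hnorm x + hnorm (X x))) => [|e e0].
  by rewrite addr_ge0 ?mulr_ge0 ?hnorm_ge0.
rewrite add0r; have [p pf] := weierstrass e0 cf.
have hA : hnorm (op_poly p A x - cfc f A x) <= e * hnorm x.
  apply: is_cfc_dist (is_cfc_poly p A) (cfcP sA Aab cf) _ x => //; first exact: ltW.
  by move=> t /(spectrum_within Aab) tab; apply: pf; rewrite in_itv.
have hB : hnorm (op_poly p B (X x) - cfc f B (X x)) <= e * hnorm (X x).
  apply: is_cfc_dist (is_cfc_poly p B) (cfcP sB Bab cf) _ (X x) => //; first exact: ltW.
  by move=> t /(spectrum_within Bab) tab; apply: pf; rewrite in_itv.
apply: le_trans (hnorm_dist (X (op_poly p A x)) _ _) _.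
have : hnorm (X (cfc f A x) - X (op_poly p A x)) <= C * (e * hnorm x).
  by rewrite hnormBC -linearB (le_trans (XC _))// ler_wpM2l.
by rewrite (op_poly_intertwine _ XA); lra.
Qed.

(** * The direct sum of two copies of a Hilbert space *)

Section DirectSum.
Context {R : realType} (H : hilbertType R).

(* An alias, because the norm that H * H carries by default is the sup norm. *)
Definition hsum : Type := (H * H)%type.
HB.instance Definition _ := GRing.Lmodule.copy hsum (H * H)%type.
Implicit Types u v w : hsum.

Definition hsum_dot u v : R[i] := hdot u.1 v.1 + hdot u.2 v.2.

Lemma hsum_dot_bilinear :
  bilinear_for (@GRing.mul R[i]) (Num.conj \; *%R) hsum_dot.
Proof.
split=> [u a v w|u a v w]; rewrite /hsum_dot /=.
- by rewrite !linearPl /= mulrDr addrACA.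
- by rewrite !linearPr /= mulrDr addrACA.
Qed.

HB.instance Definition _ := bilinear_isBilinear.Build R[i] hsum hsum R[i]
  *%R (Num.conj \; *%R) hsum_dot hsum_dot_bilinear.

Lemma hsum_dot_hermitian u v :
  hsum_dot u v = (-1) ^+ false * Num.conj (hsum_dot v u).
Proof.
by rewrite expr0 mul1r rmorphD /hsum_dot /= [in LHS](hermC hdot) /=
  [hdot u.2 _](hermC hdot) /= expr0 !mul1r.
Qed.

HB.instance Definition _ := isHermitianSesquilinear.Build R[i] hsum false
  Num.conj hsum_dot hsum_dot_hermitian.

Lemma hsum_dotxx u : hsum_dot u u = (rdot u.1 u.1 + rdot u.2 u.2)%:C.
Proof. by rewrite rmorphD /hsum_dot !hdotxx. Qed.

Lemma hsum_dot_gt0 u : u != 0 -> 0 < hsum_dot u u.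
Proof.
move=> u0; rewrite lt_neqAle hsum_dotxx lecR addr_ge0 ?rdotxx_ge0// andbT.
rewrite eq_sym; apply: contra_neq u0 => /complexI/eqP.
rewrite paddr_eq0 ?rdotxx_ge0// -!hnorm_sqr !sqrf_eq0.
move=> /andP[/eqP/hnorm_eq0 u1 /eqP/hnorm_eq0 u2].
by case: u u1 u2 => a b /= -> ->.
Qed.

HB.instance Definition _ := isDotProduct.Build R[i] hsum hsum_dot hsum_dot_gt0.

Definition hsum_hnorm u : R := Num.sqrt (rdot u.1 u.1 + rdot u.2 u.2).

Lemma hsum_hnorm_sqr u : hsum_hnorm u ^+ 2 = hnorm u.1 ^+ 2 + hnorm u.2 ^+ 2.
Proof. by rewrite sqr_sqrtr ?hnorm_sqr// addr_ge0 ?rdotxx_ge0. Qed.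

Lemma hsum_hnorm_ge0 u : 0 <= hsum_hnorm u.
Proof. exact: sqrtr_ge0. Qed.

Lemma hsum_hnorm_le u : hnorm u.1 <= hsum_hnorm u /\ hnorm u.2 <= hsum_hnorm u.
Proof.
split; rewrite -(@ler_pXn2r _ 2)// ?nnegrE ?hnorm_ge0 ?hsum_hnorm_ge0// hsum_hnorm_sqr.
- by rewrite lerDl sqr_ge0.
- by rewrite lerDr sqr_ge0.
Qed.

Lemma le_hsum_hnorm u : hsum_hnorm u <= hnorm u.1 + hnorm u.2.
Proof.
rewrite -(@ler_pXn2r _ 2)// ?nnegrE ?addr_ge0 ?hnorm_ge0 ?hsum_hnorm_ge0// hsum_hnorm_sqr.
have := mulr_ge0 (hnorm_ge0 u.1) (hnorm_ge0 u.2); lra.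
Qed.

Lemma hsum_hnormD u v : hsum_hnorm (u + v) <= hsum_hnorm u + hsum_hnorm v.
Proof.
have U := hsum_hnorm_sqr u; have V := hsum_hnorm_sqr v.
have U0 := hsum_hnorm_ge0 u; have V0 := hsum_hnorm_ge0 v.
rewrite -(@ler_pXn2r _ 2)// ?nnegrE ?addr_ge0 ?hsum_hnorm_ge0// hsum_hnorm_sqr /=.
have h (x y : H) : hnorm (x + y) ^+ 2 <= (hnorm x + hnorm y) ^+ 2.
  by rewrite ler_pXn2r ?nnegrE ?addr_ge0 ?hnorm_ge0// hnormD.
have h1 := h u.1 v.1; have h2 := h u.2 v.2.
(* Cauchy-Schwarz in the plane: the difference of the squares is the square of a determinant. *)
have CS : hnorm u.1 * hnorm v.1 + hnorm u.2 * hnorm v.2 <= hsum_hnorm u * hsum_hnorm v.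
  rewrite -(@ler_pXn2r _ 2)// ?nnegrE ?addr_ge0 ?mulr_ge0 ?hnorm_ge0//.
  rewrite exprMn U V; have := sqr_ge0 (hnorm u.1 * hnorm v.2 - hnorm u.2 * hnorm v.1); lra.
lra.
Qed.

Definition hsum_norm u : R[i] := (hsum_hnorm u)%:C.

Lemma hsum_normD u v : hsum_norm (u + v) <= hsum_norm u + hsum_norm v.
Proof. by rewrite /hsum_norm -rmorphD lecR hsum_hnormD. Qed.

Lemma hsum_normZ (a : R[i]) u : hsum_norm (a *: u) = `|a| * hsum_norm u.
Proof.
apply/eqP; rewrite -(@eqrXn2 _ 2)// ?mulr_ge0// ?lecR ?hsum_hnorm_ge0//.
rewrite exprMn /hsum_norm -!rmorphXn /= !hsum_hnorm_sqr !rmorphD !rmorphXn /= -!normE_hnorm.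
by rewrite !normrZ !exprMn mulrDr.
Qed.

Lemma hsum_norm_eq0 u : hsum_norm u = 0 -> u = 0.
Proof.
move=> /complexI u0; have [] := hsum_hnorm_le u; rewrite u0 => h1 h2.
have {}h1 : u.1 = 0 by apply/hnorm_eq0/eqP; rewrite eq_le h1 hnorm_ge0.
have {}h2 : u.2 = 0 by apply/hnorm_eq0/eqP; rewrite eq_le h2 hnorm_ge0.
by case: u h1 h2 {u0} => a b /= -> ->.
Qed.

HB.instance Definition _ := Lmodule_isNormed.Build R[i] hsum
  hsum_normD hsum_normZ hsum_norm_eq0.

Lemma hsum_ballE (u : hsum) (e : R[i]) v : ball u e v = (hsum_norm (u - v) < e).
Proof. by rewrite -ball_normE. Qed.

Lemma hsum_complete (F : set_system hsum) : ProperFilter F -> cauchy F -> cvg F.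
Proof.
move=> FF /cauchyP FC.
have c1 : cvg (fst @ F).
  apply/cauchy_cvgP/cauchyP => e e0; have [u Fu] := FC e e0.
  exists u.1; rewrite /fmap /=; apply: filterS Fu => v /=.
  rewrite hsum_ballE -ball_normE /= normE_hnorm; apply: le_lt_trans.
  by rewrite lecR; have [] := hsum_hnorm_le (u - v).
have c2 : cvg (snd @ F).
  apply/cauchy_cvgP/cauchyP => e e0; have [u Fu] := FC e e0.
  exists u.2; rewrite /fmap /=; apply: filterS Fu => v /=.
  rewrite hsum_ballE -ball_normE /= normE_hnorm; apply: le_lt_trans.
  by rewrite lecR; have [] := hsum_hnorm_le (u - v).
apply/cvg_ex; exists ((lim (fst @ F), lim (snd @ F)) : hsum).
apply/cvg_ballP => e e0.
have e20 : 0 < e / 2 by rewrite divr_gt0.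
have {c1}/cvg_ballP/(_ _ e20) c1 : fst @ F --> lim (fst @ F) by exact: c1.
have {c2}/cvg_ballP/(_ _ e20) c2 : snd @ F --> lim (snd @ F) by exact: c2.
apply: filterS2 c1 c2 => v h1 h2; rewrite hsum_ballE; move: h1 h2.
rewrite -!ball_normE /= !normE_hnorm => h1 h2; rewrite (splitr e).
apply: le_lt_trans (ltrD h1 h2).
by rewrite -rmorphD lecR le_hsum_hnorm.
Qed.

HB.instance Definition _ := Uniform_isComplete.Build hsum hsum_complete.

Lemma hsum_sqr_norm u : `|u| ^+ 2 = hsum_dot u u.
Proof.
rewrite hsum_dotxx -[`|u|]/((hsum_hnorm u)%:C) -rmorphXn hsum_hnorm_sqr.
by rewrite !hnorm_sqr.
Qed.

HB.instance Definition _ := CompleteNormedModule_isHilbert.Build R hsum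
  hsum_sqr_norm.

Lemma hsum_rdot u v : rdot u v = rdot u.1 v.1 + rdot u.2 v.2.
Proof. by rewrite /rdot -raddfD. Qed.

End DirectSum.

(** * Block operators on the direct sum *)

Section BlockOperators.
Context {R : realType} {H : hilbertType R}.
Implicit Types (A B P Q S T : bop H) (x y : H) (u v : hsum H).

Lemma hnorm_hsum u : hnorm u = hsum_hnorm u.
Proof. by rewrite /hnorm hsum_rdot. Qed.

Definition block_fun P Q S T (u : hsum H) : hsum H :=
  (P u.1 + Q u.2, S u.1 + T u.2).

Lemma block_subproof P Q S T : block_fun P Q S T \in @bounded_op R (hsum H).
Proof.
have [KP KP0 hP] := bop_bound P; have [KQ KQ0 hQ] := bop_bound Q.
have [KS KS0 hS] := bop_bound S; have [KT KT0 hT] := bop_bound T.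
apply: (@bounded_op_hnorm _ _ _ (KP + KQ + KS + KT)) => [a u v||u].
- congr pair => /=; rewrite !linearP scalerDr -!addrA; congr (_ + _);
    by rewrite addrCA.
- by rewrite !addr_ge0 ?(ltW KP0) ?(ltW KQ0) ?(ltW KS0) ?(ltW KT0).
rewrite hnorm_hsum (le_trans (le_hsum_hnorm _))//= hnorm_hsum.
have [u1 u2] := hsum_hnorm_le u.
have := hnormD (P u.1) (Q u.2); have := hnormD (S u.1) (T u.2).
have := hP u.1; have := hQ u.2; have := hS u.1; have := hT u.2.
have := ler_wpM2l (ltW KP0) u1; have := ler_wpM2l (ltW KQ0) u2.
have := ler_wpM2l (ltW KS0) u1; have := ler_wpM2l (ltW KT0) u2.
lra.
Qed.

Definition block P Q S T : bop (hsum H) := Bop (block_subproof P Q S T).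

Lemma rdot_block P Q S T u v : rdot (block P Q S T u) v =
  rdot (P u.1) v.1 + rdot (Q u.2) v.1 + (rdot (S u.1) v.2 + rdot (T u.2) v.2).
Proof. by rewrite hsum_rdot /= !rdotDl. Qed.

Lemma block_sym P Q T : sym_op P -> sym_op Q -> sym_op T -> sym_op (block P Q Q T).
Proof.
move=> sP sQ sT u v; rewrite [RHS]rdotC !rdot_block.
rewrite (sP v.1) (sQ v.2) (sQ v.1) (sT v.2) (rdotC v.1 (P _)) (rdotC v.1 (Q _)).
by rewrite (rdotC v.2 (Q _)) (rdotC v.2 (T _)) addrACA.
Qed.

(** The values c = 1, -1 and 0 parametrize the vectors (x, x), (x, -x) and (x, 0), the subspaces
    left invariant by the block operators of the concavity proof. *)
Definition hemb (c : R) x : hsum H := (x, c%:C *: x).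

Lemma hemb_linear c : linear (hemb c).
Proof.
move=> a x y; congr pair => /=.
by rewrite scalerDr !scalerA mulrC.
Qed.

HB.instance Definition _ c :=
  GRing.isLinear.Build _ _ _ _ (hemb c) (hemb_linear c).

Lemma hnorm_hemb c x : hnorm (hemb c x) <= (1 + `|c|) * hnorm x.
Proof.
by rewrite hnorm_hsum (le_trans (le_hsum_hnorm _))//= hnormZ mulrDl mul1r.
Qed.

End BlockOperators.

(** * Operator monotone functions are operator concave *)

Section Shift.
Context {R : realType} {H : hilbertType R}.
Implicit Types (A T : bop H) (p q : {poly R}) (f : R -> R) (c : R).

Lemma op_poly_comp p q A : op_poly (p \Po q) A = op_poly p (op_poly q A).
Proof.
elim/poly_ind: p => [|p c IH].
  by rewrite comp_poly0 -polyC0 !op_polyC.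
by rewrite comp_poly_MXaddC !op_polyD !op_polyM !op_polyC op_polyX IH.
Qed.

(** The spectrum of A + c is a translate of that of A, and p at A + c is p (X + c) at A. *)
Lemma is_cfc_shift f A c T : is_cfc f (A + c%:C *: (1 : bop H)) T ->
  is_cfc (fun t => f (t + c)) A T.
Proof.
move=> /is_cfcP fT; apply/is_cfcP => e /fT[p [pf pT]].
exists (p \Po ('X + c%:P)); split=> [t tA|x].
  rewrite horner_comp !hornerE; apply: pf; move: tA.
  rewrite /spectrum /= rmorphD /= scalerDl.
  by rewrite opprD addrACA subrr addr0.
by rewrite op_poly_comp op_polyD op_polyX op_polyC.
Qed.

End Shift.

Lemma scaler_half_dbl (R : realType) (V : lmodType R[i]) (v : V) :
  (2^-1)%:C *: (v + v) = v.
Proof.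
rewrite -[v + v]mulr2n -[v *+ 2]scaler_nat scalerA.
by rewrite -(rmorph_nat (real_complex R)) -rmorphM mulVf ?pnatr_eq0// rmorph1 scale1r.
Qed.

Section MonotoneCalculus.
Context {R : realType} {H : hilbertType R}.
Implicit Types (A B : bop H) (x y : H).

Lemma op_within_sub (a b a' b' : R) A : a' <= a -> b <= b' ->
  op_within a b A -> op_within a' b' A.
Proof.
move=> aa bb Aab x; have /andP[h1 h2] := Aab x.
by rewrite (le_trans _ h1) ?(le_trans h2) ?ler_wpM2r ?rdotxx_ge0.
Qed.

Lemma op_within_shift (a b e : R) A : 0 <= e -> op_within a b A ->
  op_within a (b + e) (A + e%:C *: (1 : bop H)).
Proof.
move=> e0 Aab x; have /andP[h1 h2] := Aab x; rewrite !bopE rdotDl rdotZl.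
by rewrite mulrDl lerD2r h2 andbT (le_trans h1)// lerDl mulr_ge0 ?rdotxx_ge0.
Qed.

Lemma op_within_midpoint (a b : R) A B : op_within a b A -> op_within a b B ->
  op_within a b ((2^-1)%:C *: (A + B)).
Proof.
move=> Aab Bab x; rewrite !bopE rdotZl rdotDl.
by have /andP[h1 h2] := Aab x; have /andP[h3 h4] := Bab x; lra.
Qed.

Lemma spectrum_gt0 (a b : R) A : sym_op A -> 0 < a -> op_within a b A ->
  spectrum A `<=` [set z | 0 < z].
Proof.
move=> sA a0 Aab z zA /=; have [z0|z0] := eqVneq (Im z) 0; last first.
  by exfalso; apply: zA; exact: sym_nonreal_invertible.
have zE : z = (Re z)%:C by move: z0; case: (z) => ? ? /= ->.
move: zA; rewrite zE => /(spectrum_within Aab)/andP[az _].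
by rewrite ltcR (lt_le_trans a0).
Qed.

Lemma continuous_pos_itv (f : R -> R) (a b : R) : 0 < a ->
  {in `]0, +oo[, continuous f} -> {in `[a, b], continuous f}.
Proof.
move=> a0 cf x xab; apply: cf; move: xab; rewrite !in_itv /= andbT => /andP[ax _].
exact: lt_le_trans ax.
Qed.

Lemma operator_monotone_le (f : R -> R) (a b : R) A B : operator_monotone f -> 0 < a ->
  sym_op A -> sym_op B -> op_within a b A -> op_within a b B ->
  (forall x, rdot (A x) x <= rdot (B x) x) ->
  op_le (cfc f A) (cfc f B).
Proof.
move=> [_ fm] a0 sA sB Aab Bab AB; apply: fm; [exact/self_adjointP..| | |].
- exact: spectrum_gt0 a0 Aab.
- exact: spectrum_gt0 a0 Bab.
- by apply/op_leP; split=> //; exact: sym_opB.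
Qed.

(** The shifted operator is read as the function f (t + d) of A itself, which uniform continuity
    keeps e-close to f on the spectrum of A. *)
Lemma cfc_shift_le (f : R -> R) (a b e : R) A : 0 < a -> 0 < e ->
  {in `]0, +oo[, continuous f} -> sym_op A -> op_within a b A ->
  exists2 d, 0 < d & forall x,
    rdot (cfc f (A + d%:C *: (1 : bop H)) x) x <= rdot (cfc f A x) x + e * rdot x x.
Proof.
move=> a0 e0 cf sA Aab.
have [d d0 fd] := continuous_uniformly e0 (continuous_pos_itv (b := b) a0 cf).
have d20 : 0 < d / 2 by rewrite divr_gt0.
exists (d / 2) => // x.
set B := A + _.
have sB : sym_op B by apply: sym_opD => //; apply: sym_opZ; exact: sym_op1.
have Bab : op_within a (b + d / 2) B := op_within_shift (ltW d20) Aab.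
have fB := is_cfc_shift (cfcP sB Bab (continuous_pos_itv a0 cf)).
have fA := cfcP sA Aab (continuous_pos_itv a0 cf).
have h : hnorm (cfc f B x - cfc f A x) <= e * hnorm x.
  apply: is_cfc_dist fB fA _ x => // [|t /(spectrum_within Aab) tab]; first exact: ltW.
  by apply: fd; rewrite ?in_itv// addrAC subrr add0r gtr0_norm//; lra.
have := rdot_le_hnorm (cfc f B x - cfc f A x) x.
rewrite rdotDl rdotNl lerBlDl => /le_trans; apply.
by rewrite lerD2l -hnorm_sqr expr2 mulrA ler_wpM2r ?hnorm_ge0.
Qed.

End MonotoneCalculus.

Section OperatorConcavity.
Context {R : realType} {H : hilbertType R}.
Implicit Types (A B S T : bop H) (x y : H).

Lemma operator_monotone_midpoint_shift (f : R -> R) (a b e : R) A B :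
  operator_monotone f -> 0 < a -> 0 < e -> sym_op A -> sym_op B ->
  op_within a b A -> op_within a b B ->
  forall x, rdot (cfc f A x) x + rdot (cfc f B x) x <=
    2 * rdot (cfc f ((2^-1)%:C *: (A + B) + e%:C *: (1 : bop H)) x) x.
Proof.
move=> fm a0 e0 sA sB Aab Bab x.
have cf := continuous_pos_itv (b := b) a0 fm.1.
set S := (2^-1)%:C *: (A + B); pose D := (2^-1)%:C *: (B - A).
have sS : sym_op S by apply: sym_opZ; exact: sym_opD.
have Sab : op_within a b S by exact: op_within_midpoint.
have sD : sym_op D by apply: sym_opZ; exact: sym_opB.
have [K K0 DK] := bop_bound D.
(* K^2 / e pays for the off-diagonal blocks, |b| for the form of S, and a keeps the second diagonal
   entry at least a. *)
pose l := `|b| + K ^+ 2 / e + a.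
have l1 : 0 <= K ^+ 2 / e by rewrite divr_ge0 ?sqr_ge0 ?ltW.
have Sx y z : rdot (S y) z = 2^-1 * (rdot (A y) z + rdot (B y) z).
  by rewrite !bopE rdotZl rdotDl.
have Dx y z : rdot (D y) z = 2^-1 * (rdot (B y) z - rdot (A y) z).
  by rewrite !bopE rdotZl rdotDl rdotNl.
have SDB : S + D = B.
  by rewrite /S /D -scalerDr [A + B]addrC addrACA subrr addr0 scaler_half_dbl.
have SDA : S - D = A.
  by rewrite /S /D -scalerBr opprB addrACA subrr addr0 scaler_half_dbl.
clearbody S D.
pose Se := S + e%:C *: (1 : bop H).
have sSe : sym_op Se by apply: sym_opD => //; apply: sym_opZ; exact: sym_op1.
pose M := block S D D S.
(* A common upper bound for the forms of M, N and Se. *)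
pose c := `|b| + e + l.
have sM : sym_op M by exact: block_sym.
(* The form of M at u is half the sum of the form of B at u.1 + u.2 and that of A at u.1 - u.2; the
   parallelogram law concludes. *)
have Mab : op_within a b M.
  move=> u; rewrite rdot_block hsum_rdot !Sx !Dx.
  have := Bab (u.1 + u.2); have := Aab (u.1 - u.2).
  rewrite !linearB !linearD /= !rdotDl !rdotDr !rdotNl !rdotNr.
  have := sA u.1 u.2; have := sB u.1 u.2; rewrite (rdotC u.1 (A _)) (rdotC u.1 (B _)).
  rewrite (rdotC u.2 u.1); clear; lra.
have bb := ler_norm b.
have al : a <= l by rewrite lerDr addr_ge0.
have bl : b + K ^+ 2 / e <= l.
  by rewrite /l; move: (K ^+ 2 / e) (ltW a0) bb => k; clear; lra.
have l0 : 0 <= l by exact: le_trans (ltW a0) al.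
have bc : b + e <= c by move: bb l0; rewrite /c; clear; lra.
have lc : l <= c by rewrite lerDr addr_ge0 ?(ltW e0).
clearbody c; clearbody l.
pose N := block Se 0 0 (l%:C *: (1 : bop H)).
have sN : sym_op N.
  by apply: block_sym => //; [exact: sym_op0|apply: sym_opZ; exact: sym_op1].
have Nx u : rdot (N u) u =
    rdot (S u.1) u.1 + e * rdot u.1 u.1 + l * rdot u.2 u.2.
  by rewrite rdot_block !bopE !rdotDl !rdotZl !rdot0l; ring.
have Nac : op_within a c N.
  move=> u; rewrite Nx hsum_rdot; have /andP[h1 h2] := Sab u.1.
  have X0 := rdotxx_ge0 u.1; have Y0 := rdotxx_ge0 u.2.
  have p1 := mulr_ge0 (ltW e0) X0; have p2 := ler_wpM2r Y0 al.
  have p3 := ler_wpM2r X0 bc; have p4 := ler_wpM2r Y0 lc.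
  by move: h1 h2 p1 p2 p3 p4; clear; lra.
have Seac : op_within a c Se.
  move=> y; rewrite !bopE rdotDl rdotZl; have /andP[h1 h2] := Sab y.
  have X0 := rdotxx_ge0 y; have p1 := mulr_ge0 (ltW e0) X0.
  have p3 := ler_wpM2r X0 bc; by move: h1 h2 p1 p3; clear; lra.
have Mac : op_within a c M.
  by apply: (op_within_sub _ _ Mab) => //; move: bc (ltW e0); clear; lra.
have MN u : rdot (M u) u <= rdot (N u) u.
  rewrite Nx rdot_block (sD u.2) (rdotC u.2).
  have /andP[_ h2] := Sab u.2.
  (* Young's inequality, with weights such that the part in u.1 is exactly the e added to S. *)
  have h3 : 2 * rdot (D u.1) u.2 <= e * rdot u.1 u.1 + K ^+ 2 / e * rdot u.2 u.2.
    have h4 := rdot_le_hnorm (D u.1) u.2.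
    have h5 := ler_wpM2r (hnorm_ge0 u.2) (DK u.1).
    apply: (@le_trans _ _ (2 * (K * hnorm u.1 * hnorm u.2))); first by lra.
    rewrite -!hnorm_sqr -subr_ge0.
    have -> : e * hnorm u.1 ^+ 2 + K ^+ 2 / e * hnorm u.2 ^+ 2 -
        2 * (K * hnorm u.1 * hnorm u.2)
      = (e * hnorm u.1 - K * hnorm u.2) ^+ 2 / e by field; rewrite lt0r_neq0.
    by rewrite divr_ge0 ?sqr_ge0 ?ltW.
  have p := ler_wpM2r (rdotxx_ge0 u.2) bl.
  by move: p h2 h3; clear; rewrite mulrDl; lra.
have /op_leP[_ fMN] := operator_monotone_le fm a0 sM sN Mac Nac MN.
have c1 : {in `[a, c], continuous f} := continuous_pos_itv a0 fm.1.
(* Images by f are transported along the embeddings: M restricts to B on (x, x) and to A on (x, -x),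
   N to Se on (x, 0). *)
have f1 : hemb 1 (cfc f B x) = cfc f M (hemb 1 x).
  apply: (cfc_intertwine sB sM Bab Mab cf _ (hnorm_hemb 1)) => [|y].
    by rewrite addr_ge0.
  rewrite /= /hemb /block_fun /= !scale1r.
  by rewrite [D y + _]addrC -SDB.
have f2 : hemb (-1) (cfc f A x) = cfc f M (hemb (-1) x).
  apply: (cfc_intertwine sA sM Aab Mab cf _ (hnorm_hemb (-1))) => [|y].
    by rewrite addr_ge0.
  rewrite /= /hemb /block_fun /= !rmorphN1 !scaleN1r !linearN /=.
  by rewrite -[D y - _]opprB -SDA.
have f3 : hemb 0 (cfc f Se x) = cfc f N (hemb 0 x).
  apply: (cfc_intertwine sSe sN Seac Nac c1 _ (hnorm_hemb 0)) => [|y].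
    by rewrite addr_ge0.
  rewrite /= /hemb /block_fun /= !scale0r; congr pair.
    by rewrite -[RHS]/(Se y + 0) addr0.
  by rewrite -[RHS]/(0 + l%:C *: 0) scaler0 addr0.
have h0 : hemb 0 x = (2^-1)%:C *: (hemb 1 x + hemb (-1) x).
  rewrite -[RHS]/(_, _) /hemb /=; congr pair; first by rewrite scaler_half_dbl.
  by rewrite -scalerDl -rmorphD subrr rmorph0 !scale0r scaler0.
have fM0 : cfc f M (hemb 0 x) =
    (2^-1)%:C *: (hemb 1 (cfc f B x) + hemb (-1) (cfc f A x)).
  by rewrite h0 linearZ linearD /= -f1 -f2.
have := fMN (hemb 0 x); rewrite -f3 fM0 !hsum_rdot /= scale0r !rdot0r !addr0.
have half_le (p q r : R) : 2^-1 * (p + q) <= r -> q + p <= 2 * r by lra.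
by rewrite rdotZl rdotDl; exact: half_le.
Qed.

(** A small enough shift changes the quadratic form by at most e times |x|^2, and e is arbitrary. *)
Lemma operator_monotone_midpoint_concave (f : R -> R) (a b : R) A B :
  operator_monotone f -> 0 < a -> sym_op A -> sym_op B ->
  op_within a b A -> op_within a b B ->
  op_le ((2^-1)%:C *: (cfc f A + cfc f B)) (cfc f ((2^-1)%:C *: (A + B))).
Proof.
move=> fm a0 sA sB Aab Bab.
have cf := continuous_pos_itv (b := b) a0 fm.1.
have sS : sym_op ((2^-1)%:C *: (A + B)) by apply: sym_opZ; exact: sym_opD.
have Sab := op_within_midpoint Aab Bab.
apply/op_leP; split=> [|x].
  apply: sym_opB; first exact: is_cfc_sym (cfcP sS Sab cf).
  by apply: sym_opZ; apply: sym_opD; [exact: is_cfc_sym (cfcP sA Aab cf)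
                               |exact: is_cfc_sym (cfcP sB Bab cf)].
apply: (@ler_addgt0_mulr _ _ _ (rdot x x)) => [|e e0]; first exact: rdotxx_ge0.
have [d d0 dS] := cfc_shift_le a0 e0 fm.1 sS Sab.
have -> : rdot (((2^-1)%:C *: (cfc f A + cfc f B)) x) x =
    2^-1 * (rdot (cfc f A x) x + rdot (cfc f B x) x).
  by rewrite !bopE rdotZl rdotDl.
have half_le (p q r s : R) : p + q <= 2 * r -> r <= s -> 2^-1 * (p + q) <= s.
  by lra.
exact: half_le (operator_monotone_midpoint_shift fm a0 d0 sA sB Aab Bab x) (dS x).
Qed.

End OperatorConcavity.

(** * The geometric mean *)

Lemma continuous_powR (R : realType) (r : R) :
  {in `]0, +oo[, continuous (fun t => t `^ r)}.
Proof.
move=> t t0; apply/differentiable_continuous/derivable1_diffP.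
exact: derivable_powR.
Qed.

Section GeometricMean.
Context {R : realType} {H : hilbertType R}.
Implicit Types (A B S T Q : bop H) (x y : H) (f g : R -> R).

Lemma continuous_itv_bounded f (a b : R) : {in `[a, b], continuous f} ->
  exists F, forall t, a <= t <= b -> `|f t| <= F.
Proof.
move=> cf; have cf' : {within `[a, b], continuous f}.
  by apply: continuous_in_subspaceT => x; rewrite inE /= => /cf.
have [M [_ MP]] := compact_bounded (continuous_compact cf' (@segment_compact R a b)).
exists (M + 1) => t tab; apply: (MP (M + 1)); first by rewrite ltrDl.
by exists t => //=; rewrite in_itv.
Qed.

Lemma is_cfc_mul f g A (a b : R) : sym_op A -> op_within a b A ->
  {in `[a, b], continuous f} -> {in `[a, b], continuous g} ->
  is_cfc (fun t => f t * g t) A (cfc f A * cfc g A).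
Proof.
move=> sA Aab cf cg.
have [F fF] := continuous_itv_bounded cf; have [G gG] := continuous_itv_bounded cg.
apply: (is_cfcM sA (cfcP sA Aab cf) (cfcP sA Aab cg)) => t /(spectrum_within Aab).
  exact: fF.
exact: gG.
Qed.

Lemma op_powRM A (a b r s : R) : sym_op A -> 0 < a -> op_within a b A ->
  is_cfc (fun t => t `^ (r + s)) A (op_powR A r * op_powR A s).
Proof.
move=> sA a0 Aab.
have cf q := continuous_pos_itv (b := b) a0 (@continuous_powR R q).
apply: (eq_is_cfc _ (is_cfc_mul sA Aab (cf r) (cf s))) => t /(spectrum_within Aab).
move=> /andP[at_ _]; rewrite powRD// (_ : (t != 0)) ?implybT//.
by rewrite lt0r_neq0// (lt_le_trans a0).
Qed.

Lemma op_powR_mul1 A (a b r s : R) : sym_op A -> 0 < a -> op_within a b A ->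
  r + s = 1 -> op_powR A r * op_powR A s = A.
Proof.
move=> sA a0 Aab rs; have := op_powRM r s sA a0 Aab; rewrite rs => h.
apply: (is_cfc_unique sA h); rewrite -[X in is_cfc _ _ X]op_polyX.
apply: eq_is_cfc (is_cfc_poly 'X A) => t /(spectrum_within Aab)/andP[at_ _].
by rewrite hornerX powRr1// (le_trans (ltW a0)).
Qed.

Lemma op_powR_mul0 A (a b r s : R) : sym_op A -> 0 < a -> op_within a b A ->
  r + s = 0 -> op_powR A r * op_powR A s = 1.
Proof.
move=> sA a0 Aab rs; have := op_powRM r s sA a0 Aab; rewrite rs => h.
apply: (is_cfc_unique sA h).
rewrite -[X in is_cfc _ _ X]scale1r -(rmorph1 (real_complex R)) -(op_polyC _ A).
by apply: eq_is_cfc (is_cfc_poly _ A) => t _; rewrite hornerC powRr0.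
Qed.

Lemma op_powR_sym A (a b r : R) : sym_op A -> 0 < a -> op_within a b A ->
  sym_op (op_powR A r).
Proof.
move=> sA a0 Aab; apply: is_cfc_sym (cfcP sA Aab _) => //.
exact: continuous_pos_itv (@continuous_powR R r).
Qed.

Lemma op_sqrt_within A (a b : R) : sym_op A -> 0 < a -> op_within a b A ->
  op_within (Num.sqrt a) (Num.sqrt b) (op_powR A 2^-1).
Proof.
move=> sA a0 Aab x.
have fA := cfcP sA Aab (continuous_pos_itv a0 (@continuous_powR R 2^-1)).
have cE c : rdot (op_poly c%:P A x) x = c * rdot x x.
  by rewrite op_polyC !bopE rdotZl.
rewrite -!cE; apply/andP; split.
  apply: (is_cfc_le sA (is_cfc_poly _ A) fA) => t /(spectrum_within Aab)/andP[at_ _].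
  by rewrite hornerC powR12_sqrt ?ler_wsqrtr// (le_trans (ltW a0)).
apply: (is_cfc_le sA fA (is_cfc_poly _ A)) => t /(spectrum_within Aab)/andP[at_ tb].
by rewrite hornerC powR12_sqrt ?ler_wsqrtr// (le_trans (ltW a0)).
Qed.

(** Here S = A^(1/2) and Q is the square root of D = A^(-1/2) B A^(-1/2). Comparing B with A at
    A^(-1/2) x bounds D between k and l; the later inequalities use only this algebraic
    factorization. *)
Lemma geo_meanP A B (a b k l : R) : 0 < a -> 0 < k -> sym_op A -> sym_op B ->
  op_within a b A ->
  (forall x, k * rdot (A x) x <= rdot (B x) x <= l * rdot (A x) x) ->
  exists S Q, [/\ sym_op S, sym_op Q, S * S = A, S * (Q * Q) * S = B &
    geo_mean A B = S * Q * S /\ op_within (Num.sqrt k) (Num.sqrt l) Q].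
Proof.
move=> a0 k0 sA sB Aab AB.
pose S := op_powR A 2^-1; pose T := op_powR A (- 2^-1).
have half2 : 2^-1 + 2^-1 = 1 :> R by lra.
have SS : S * S = A by exact: op_powR_mul1 Aab half2.
have ST : S * T = 1 by apply: op_powR_mul0 Aab _ => //; rewrite subrr.
have TS : T * S = 1 by apply: op_powR_mul0 Aab _ => //; rewrite addNr.
have sS : sym_op S by exact: op_powR_sym Aab.
have sT : sym_op T by exact: op_powR_sym Aab.
pose D := T * B * T.
have sD : sym_op D by move=> x y; rewrite /D !bopE sT sB sT.
have TAT : T * A * T = 1 by rewrite -SS mulrA TS mul1r ST.
have Dkl : op_within k l D.
  move=> x; have := AB (T x).
  have -> : rdot (A (T x)) (T x) = rdot x x by rewrite -sT -[T (A _)]/((T * A * T) x) TAT.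
  by rewrite -sT.
exists S, (op_powR D 2^-1); split=> //; first exact: op_powR_sym Dkl.
  rewrite (op_powR_mul1 sD k0 Dkl half2) /D !mulrA ST mul1r -mulrA TS mulr1//.
by split=> //; exact: op_sqrt_within.
Qed.

End GeometricMean.

(** * Inequalities for the geometric mean *)

Section MeanInequalities.
Context {R : realType} {H : hilbertType R}.
Implicit Types (A B S Q : bop H) (x y : H).

Lemma strictly_positive_within A : strictly_positive_op A ->
  sym_op A /\ exists a b : R, [/\ 0 < a, 0 < b & op_within a b A].
Proof.
move=> [/positive_opP[sA A0] iA]; split=> //.
have [a a0 Aa] := pos_invertible_coercive sA A0 iA.
have [b b0 bA] := bop_bound A; exists a, b; split=> // x.
rewrite Aa /= (le_trans (rdot_le_hnorm _ _))// -hnorm_sqr expr2 mulrA.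
by rewrite ler_wpM2r ?hnorm_ge0.
Qed.

Lemma geo_mean_le_arith A B : strictly_positive_op A -> strictly_positive_op B ->
  op_le (geo_mean A B) ((2^-1)%:C *: (A + B)).
Proof.
move=> /strictly_positive_within[sA [a [b [a0 b0 Aab]]]].
move=> /strictly_positive_within[sB [c [d [c0 d0 Bcd]]]].
(* From A <= b and c <= B follows (c / b) A <= B; from a <= A and B <= d follows B <= (d / a) A. *)
have [||S [Q [sS sQ SS SQQS [-> _]]]] :=
  @geo_meanP _ _ A B a b (c / b) (d / a) a0 _ sA sB Aab.
- exact: divr_gt0.
- move=> x; have /andP[h1 h2] := Aab x; have /andP[h3 h4] := Bcd x.
  apply/andP; split.
    apply: le_trans h3; rewrite mulrAC ler_pdivrMr// -mulrA ler_wpM2l ?(ltW c0)//.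
    by rewrite mulrC.
  apply: (le_trans h4); rewrite mulrAC ler_pdivlMr// -mulrA.
  by rewrite ler_wpM2l ?(ltW d0)// mulrC.
apply/op_leP; split.
  apply: sym_opB; first by apply: sym_opZ; exact: sym_opD.
  by move=> x y; rewrite !bopE sS sQ sS.
move=> x; rewrite -SS -SQQS !bopE rdotZl rdotDl.
rewrite (sS (Q (S x))) (sS (S x)) (sS (Q (Q (S x)))) (sQ (Q (S x))).
(* Half of this square is the form of the difference of the two means at x. *)
have := rdotxx_ge0 (S x - Q (S x)).
rewrite rdotDl !rdotDr !rdotNl !rdotNr (rdotC (S x) (Q _)).
move: (rdot (S x) (S x)) (rdot (Q (S x)) (S x)) (rdot (Q (S x)) (Q (S x))).
by move=> p q r; lra.
Qed.

(** The hypothesis gives m <= Q <= M in the factorization of [geo_meanP], and the form of (M - Q)(Q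
    - m) at S x is the gap between the two sides at x. *)
Lemma sandwich_geo_mean A B (a b m M : R) : 0 < a -> 0 < m -> 0 <= M ->
  sym_op A -> sym_op B -> op_within a b A ->
  (forall x, m ^+ 2 * rdot (A x) x <= rdot (B x) x <= M ^+ 2 * rdot (A x) x) ->
  positive_op (geo_mean A B) /\
  op_le ((M * m)%:C *: A + B) ((M + m)%:C *: geo_mean A B).
Proof.
move=> a0 m0 M0 sA sB Aab AB.
have m20 : 0 < m ^+ 2 by rewrite exprn_gt0.
have [S [Q [sS sQ SS SQQS [gE]]]] := geo_meanP a0 m20 sA sB Aab AB.
rewrite !sqrtr_sqr !ger0_norm ?(ltW m0)// => QmM.
have sG : sym_op (geo_mean A B) by rewrite gE => x y; rewrite !bopE sS sQ sS.
split.
  apply/positive_opP; split=> // x; rewrite gE !bopE sS.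
  have /andP[+ _] := QmM (S x); apply: le_trans.
  by rewrite mulr_ge0 ?rdotxx_ge0 ?ltW.
apply/op_leP; split.
  by apply: sym_opB; [exact: sym_opZ|apply: sym_opD => //; exact: sym_opZ].
(* Both factors are polynomials in Q, so positivity of their product is checked on scalars of
   [m, M]. *)
move=> x; have [p pE] : exists p : {poly R}, p = (M%:P - 'X) * ('X - m%:P) by eexists.
have := @op_poly_ge0 _ _ p Q sQ _ (S x); rewrite pE => /(_ _)/wrap[].
  move=> t /(spectrum_within QmM)/andP[mt tM].
  by rewrite !hornerE mulr_ge0 ?subr_ge0.
rewrite op_polyM !op_polyB op_polyX !op_polyC gE -SQQS -SS !bopE.
rewrite !linearB !linearZ /= !(rdotDl, rdotNl, rdotZl).
rewrite (sS (Q (S x))) (sS (Q (Q (S x)))) (sS (S x)).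
by move: (rdot (Q (S x)) _) (rdot (Q (Q (S x))) _) (rdot (S x) _) => q r s; lra.
Qed.

Lemma positive_map_le (Phi : {linear bop H -> bop H}) A B : positive_map Phi ->
  op_le A B -> op_le (Phi A) (Phi B).
Proof. by move=> pPhi /pPhi; rewrite linearB. Qed.

Lemma op_le_within A (a b : R) : op_le (a%:C *: (1 : bop H)) A ->
  op_le A (b%:C *: (1 : bop H)) -> op_within a b A.
Proof.
move=> /op_leP[_ aA] /op_leP[_ Ab] x.
by have := aA x; have := Ab x; rewrite !bopE !rdotZl => -> ->.
Qed.

End MeanInequalities.

(* The geometric mean is defined for strictly positive operators only, so the
   last inequality is stated whenever its right-hand side is defined. *)
Theorem theorem2p1 (R : realType) (H : hilbertType R) (A B : bop H)
    (m1 M1 m2 M2 : R) (Phi : {linear bop H -> bop H}) (f : R -> R) :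
  strictly_positive_op A -> strictly_positive_op B ->
  0 < m1 -> m1 < M1 -> 0 < m2 -> m2 < M2 ->
  op_le ((m1 ^+ 2)%:C *: (1 : bop H)) A -> op_le A ((M1 ^+ 2)%:C *: (1 : bop H)) ->
  op_le ((m2 ^+ 2)%:C *: (1 : bop H)) B -> op_le B ((M2 ^+ 2)%:C *: (1 : bop H)) ->
  positive_map Phi -> Phi 1 = 1 ->
  operator_monotone f ->
  let m := m2 / M1 in
  let M := M2 / m1 in
  let fA := cfc f ((M * m)%:C *: Phi A) in
  let fB := cfc f (Phi B) in
  let fAB := cfc f ((2^-1)%:C *: ((M * m)%:C *: Phi A + Phi B)) in
  [/\ op_le fAB (cfc f (((M + m) / 2)%:C *: Phi (geo_mean A B))),
      op_le ((2^-1)%:C *: (fA + fB)) fAB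
    & strictly_positive_op fA -> strictly_positive_op fB ->
      op_le (geo_mean fA fB) ((2^-1)%:C *: (fA + fB))].
Proof.
move=> [pA _] [pB _] m10 mM1 m20 mM2 m1A AM1 m2B BM2 pPhi Phi1 fm m M fA fB fAB.
have M10 : 0 < M1 by exact: lt_trans mM1.
have M20 : 0 < M2 by exact: lt_trans mM2.
have m0 : 0 < m by exact: divr_gt0.
have M0 : 0 < M by exact: divr_gt0.
have Mm0 : 0 < M * m by exact: mulr_gt0.
have [sA _] := (positive_opP A).1 pA; have [sB _] := (positive_opP B).1 pB.
have Aw := op_le_within m1A AM1; have Bw := op_le_within m2B BM2.
(* The lower bound combines m2^2 <= B with A <= M1^2, the upper one B <= M2^2 with m1^2 <= A. *)
have AB x : m ^+ 2 * rdot (A x) x <= rdot (B x) x <= M ^+ 2 * rdot (A x) x.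
  have /andP[a1 a2] := Aw x; have /andP[b1 b2] := Bw x; apply/andP; split.
    apply: le_trans b1; rewrite /m expr_div_n [leLHS]mulrAC ler_pdivrMr ?exprn_gt0//.
    by rewrite -[leRHS]mulrA ler_wpM2l ?sqr_ge0// mulrC.
  apply: (le_trans b2); rewrite /M expr_div_n [leRHS]mulrAC ler_pdivlMr ?exprn_gt0//.
  by rewrite -[leLHS]mulrA ler_wpM2l ?sqr_ge0// mulrC.
have [pG ABG] := sandwich_geo_mean (exprn_gt0 2 m10) m0 (ltW M0) sA sB Aw AB.
clearbody m M; clear AB.
(* Scalar operators are fixed by [Phi], so the bounds on A and B pass to their images. *)
have Phi_scal (c : R) : Phi (c%:C *: (1 : bop H)) = c%:C *: (1 : bop H).
  by rewrite linearZ /= Phi1.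
have [sPA _] := (positive_opP _).1 (pPhi _ pA).
have [sPB _] := (positive_opP _).1 (pPhi _ pB).
have [sPG _] := (positive_opP _).1 (pPhi _ pG).
have PAw : op_within (m1 ^+ 2) (M1 ^+ 2) (Phi A).
  by apply: op_le_within; rewrite -Phi_scal; exact: positive_map_le.
have PBw : op_within (m2 ^+ 2) (M2 ^+ 2) (Phi B).
  by apply: op_le_within; rewrite -Phi_scal; exact: positive_map_le.
have PhiX : Phi ((M * m)%:C *: A + B) = (M * m)%:C *: Phi A + Phi B.
  by rewrite linearD linearZ.
have PhiG : Phi ((M + m)%:C *: geo_mean A B) = (M + m)%:C *: Phi (geo_mean A B).
  by rewrite linearZ.
have Mm1 : 0 < M * m * m1 ^+ 2 by rewrite mulr_gt0 ?exprn_gt0.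
have Mm2 : 0 < M * m * M1 ^+ 2 by rewrite mulr_gt0 ?exprn_gt0.
have sX : sym_op ((M * m)%:C *: Phi A) by exact: sym_opZ.
(* A common interval for both operators, with a > 0 so that f is continuous on it. *)
pose a := Num.min (M * m * m1 ^+ 2) (m2 ^+ 2).
pose b := Num.max (M * m * M1 ^+ 2) (M2 ^+ 2).
have a0 : 0 < a by rewrite lt_min Mm1 exprn_gt0.
have Xw : op_within a b ((M * m)%:C *: Phi A).
  apply: (@op_within_sub _ _ (M * m * m1 ^+ 2) (M * m * M1 ^+ 2)).
  - by rewrite ge_min lexx.
  - by rewrite le_max lexx.
  move=> x; have /andP[h1 h2] := PAw x; rewrite !bopE rdotZl.
  by rewrite -[X in X <= _]mulrA -[X in _ && (_ <= X)]mulrA !ler_pM2l// h1 h2.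
have Yw : op_within a b (Phi B).
  apply: (op_within_sub _ _ PBw); first by rewrite ge_min lexx orbT.
  by rewrite le_max lexx orbT.
split; last exact: geo_mean_le_arith.
- rewrite /fAB; set U := (2^-1)%:C *: _; set V := (_ / 2)%:C *: _.
  have sU : sym_op U by apply: sym_opZ; exact: sym_opD.
  have sV : sym_op V by exact: sym_opZ.
  have UV x : rdot (U x) x <= rdot (V x) x.
    have /op_leP[_ /(_ x)] := positive_map_le pPhi ABG.
    rewrite PhiX PhiG /U /V !(bopE, rdotZl, rdotDl).
    by move: (rdot _ x) (rdot _ x) (rdot _ x) => p q r; lra.
  have Uw : op_within a b U by exact: op_within_midpoint.
  (* V inherits the lower bound a from U <= V; its upper bound comes from boundedness. *)
  have [K K0 VK] := bop_bound V.
  have Vw : op_within a (Num.max b K) V.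
    move=> x; have /andP[h1 _] := Uw x; rewrite (le_trans h1 (UV x)) /=.
    rewrite (le_trans (rdot_le_hnorm _ _))// -hnorm_sqr expr2 mulrA ler_wpM2r ?hnorm_ge0//.
    by rewrite (le_trans (VK x))// ler_wpM2r ?hnorm_ge0// le_max lexx orbT.
  apply: (operator_monotone_le fm a0 sU sV _ Vw UV).
  by apply: (op_within_sub _ _ Uw) => //; rewrite le_max lexx.
- exact: operator_monotone_midpoint_concave fm a0 sX sPB Xw Yw.
Qed.
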